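(* A set $K\subseteq\mathbb{R}^n$ is a maximal lattice-free convex set if and only if it satisfies one of the following conditions: (a) $K=a+L$, where $a\in\mathbb{R}^n$ and $L$ is a subspace of dimension $n-1$ that is not a lattice subspace. (b) $K$ is an $n$-dimensional polyhedron of the form $K=Q+L$, where $L$ is a lattice subspace of dimension $r$, with $r<n$, $Q$ is a polytope of dimension $n-r$, and the relative interior of every facet of $K$ contains an integer point.
   Context: A closed convex set $K\subseteq\mathbb{R}^n$ is lattice-free if its (topological) interior contains no point of $\mathbb{Z}^n$. A lattice-free convex set is maximal if it is not properly contained in any lattice-free (closed) convex set. A linear subspace $H\subseteq\mathbb{R}^n$ is a lattice subspace if $\dim(H\cap\mathbb{Z}^n)=\dim(H)$, i.e. if $H$ can be generated by a basis of integral vectors; equivalently, $H=\{x\in\mathbb{R}^n: Ax=0\}$ for some integral $(n-\dim H)\times n$ matrix $A$ of full row rank. In (a) and (b), $L$ is a linear subspace of $\mathbb{R}^n$. An integer point is a point of $\mathbb{Z}^n$. Sums of sets are Minkowski sums. A polytope is a bounded polyhedron.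
   Formalization: Condition (b) additionally requires that K be lattice-free (otherwise K=[0,2] in dimension 1 satisfies (b) but has 1 in its interior), and n ≥ 1 is assumed (for n=0 the empty set is maximal lattice-free but satisfies neither (a) nor (b)). *)

(* Defs.v *)
From HB Require Import structures.
From mathcomp Require Import all_boot all_order all_algebra.
From mathcomp Require Import all_classical all_reals all_analysis.

Set Implicit Arguments.
Unset Strict Implicit.
Unset Printing Implicit Defensive.

Import Order.TTheory GRing.Theory Num.Theory.
Import numFieldNormedType.Exports.

Local Open Scope classical_set_scope.
Local Open Scope ring_scope.

(* Points of R^n are row vectors. *)

Definition integer_points (R : realType) (n : nat) : set 'rV[R]_n :=
  [set z | z \is a mxOver Num.int].

Definition minkowski_sum (R : realType) (n : nat) (A B : set 'rV[R]_n) :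
    set 'rV[R]_n :=
  [set a + b | a in A & b in B].

(* The case k = 0 contributes nothing, since an empty sum is not 1. *)
Definition affine_hull (R : realType) (n : nat) (S : set 'rV[R]_n) :
    set 'rV[R]_n :=
  [set x | exists (k : nat) (p : 'I_k -> 'rV[R]_n) (c : 'I_k -> R),
     [/\ forall i, S (p i), \sum_i c i = 1 & x = \sum_i c i *: p i]].

(* The dimension of a set is that of its affine hull; the empty set has no
   dimension.  For S containing 0 this is the dimension of the linear span. *)
Definition has_dim (R : realType) (n : nat) (S : set 'rV[R]_n) (d : nat) :
    Prop :=
  exists (a : 'rV[R]_n) (V : {vspace 'rV[R]_n}),
    affine_hull S = minkowski_sum [set a] [set` V] /\ \dim V = d.

Definition relative_interior (R : realType) (n : nat) (S : set 'rV[R]_n) :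
    set 'rV[R]_n :=
  [set x | S x /\
     exists2 U : set 'rV[R]_n, nbhs x U & U `&` affine_hull S `<=` S].

Definition lattice_free (R : realType) (n : nat) (K : set 'rV[R]_n) : Prop :=
  [/\ closed K, convex_set K & K° `&` @integer_points R n = set0].

Definition maximal_lattice_free (R : realType) (n : nat) (K : set 'rV[R]_n) :
    Prop :=
  lattice_free K /\
  forall K' : set 'rV[R]_n, lattice_free K' -> ~ (K `<` K').

Definition lattice_subspace (R : realType) (n : nat)
    (H : {vspace 'rV[R]_n}) : Prop :=
  has_dim ([set` H] `&` @integer_points R n) (\dim H).

Definition polyhedron (R : realType) (n : nat) (P : set 'rV[R]_n) : Prop :=
  exists (m : nat) (A : 'M[R]_(n, m)) (b : 'rV[R]_m),
    P = [set x | forall i, (x *m A) 0 i <= b 0 i].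

Definition polytope (R : realType) (n : nat) (P : set 'rV[R]_n) : Prop :=
  polyhedron P /\ bounded_set P.

(* F is cut out of P by an inequality valid on P; c = 0 is allowed, so P and
   the empty set are faces. *)
Definition face (R : realType) (n : nat) (P F : set 'rV[R]_n) : Prop :=
  exists (c : 'cV[R]_n) (delta : R),
    (forall x, P x -> (x *m c) 0 0 <= delta) /\
    F = P `&` [set x | (x *m c) 0 0 = delta].

Definition facet (R : realType) (n : nat) (P F : set 'rV[R]_n) : Prop :=
  face P F /\ exists d : nat, has_dim P d.+1 /\ has_dim F d.

(* Main.v *)
Require Import Defs.
From HB Require Import structures.
From mathcomp Require Import all_boot all_order all_algebra.
From mathcomp Require Import all_classical all_reals all_analysis.
From mathcomp Require Import ring lra.

Set Implicit Arguments.
Unset Strict Implicit.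
Unset Printing Implicit Defensive.

Import Order.TTheory GRing.Theory Num.Theory.
Import numFieldNormedType.Exports.

Local Open Scope classical_set_scope.
Local Open Scope ring_scope.

(* Let K be maximal lattice-free.  If K has empty interior it lies in a
   hyperplane, hence equals it, and the hyperplane is not a lattice hyperplane
   because otherwise K would extend to a slab between two consecutive lattice
   levels.  If K has an interior point, let L be its lineality space and p the
   projection along L.  Whenever the closure of K + R u stays lattice-free, u lies
   in L; by Dirichlet's theorem this applies to every recession direction, and it
   applies to every limit direction of small nonzero vectors p z with z integer.
   Compactness of the unit sphere then shows that p(K) is bounded and that p maps
   the integer points to a discrete set, so L is a lattice subspace.  Hence finitely
   many integer points, each separated from K by one inequality, together with
   bounds on p already describe K: K is a polyhedron.  If no integer point lay in
   the relative interior of a facet, all these inequalities could be chosen strict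
   at a relative interior point of the facet, which would then be interior to K.

   Conversely, a functional whose kernel is not a lattice hyperplane takes dense
   values on the integer points, so no slab with this kernel is lattice-free; and
   in the polyhedral case the integer point of a violated facet becomes interior
   in any larger convex set. *)

(** * Topology of row vectors in terms of the norm *)

Lemma interior_normP (R : realType) n (A : set 'rV[R]_n) x :
  A° x <-> exists2 e : R, 0 < e & forall y, `|y - x| < e -> A y.
Proof.
split.
  move=> /nbhs_ballP[e /= e0 eA]; exists e => // y yx; apply: eA.
  by rewrite -ball_normE /ball_ /= distrC.
move=> [e e0 eA]; apply/nbhs_ballP; exists e => //= y.
by rewrite -ball_normE /ball_ /= distrC; exact: eA.
Qed.

Lemma closed_normP (R : realType) n (A : set 'rV[R]_n) :
  closed A <->
  forall x, (forall e : R, 0 < e -> exists2 y, A y & `|y - x| < e) -> A x.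
Proof.
split=> [cA x Ax|cA x clx].
  apply: cA => B /nbhs_ballP[e /= e0 eB].
  have [y Ay yx] := Ax e e0; exists y; split=> //; apply: eB.
  by rewrite -ball_normE /ball_ /= distrC.
apply: cA => e e0; have [|y [Ay yx]] := clx (ball x e).
  exact: nbhsx_ballx.
by exists y => //; move: yx; rewrite -ball_normE /ball_ /= distrC.
Qed.

(** [convex_set] quantifies over scalars packaged with their interval; this form takes a plain real
    t with two inequalities. *)
Lemma convex_setP (R : realType) n (A : set 'rV[R]_n) :
  convex_set A <->
  forall x y (t : R), 0 <= t -> t <= 1 -> A x -> A y ->
    A ((1 - t) *: x + t *: y).
Proof.
split=> [cA x y t t0 t1 Ax Ay|cA x y l /set_mem Ax /set_mem Ay].
  have [->|tn1] := eqVneq t 1; first by rewrite subrr scale0r add0r scale1r.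
  have h : Itv.spec (@Itv.num_sem R) (Itv.Real `[0%Z, 1%Z]) t.
    by rewrite /Itv.spec /= /Itv.num_sem ger0_real //= in_itv /= t0 t1.
  have := cA y x (Itv.mk h) (mem_set Ay) (mem_set Ax).
  by rewrite inE /conv /= addrC.
apply/mem_set.
have := cA y x (l%:num) _ _ Ay Ax; rewrite addrC; apply.
  exact: ge0.
exact: le1.
Qed.

(** * Dot product and norm estimates *)

Definition dot (R : realType) n (x u : 'rV[R]_n) : R := (x *m u^T) 0 0.

Section Dot.
Variables (R : realType) (n : nat).
Implicit Types x y u v : 'rV[R]_n.

Lemma dotE x u : dot x u = \sum_i x 0 i * u 0 i.
Proof. by rewrite /dot mxE; apply: eq_bigr => i _; rewrite mxE. Qed.

Lemma dotC x u : dot x u = dot u x.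
Proof. by rewrite !dotE; apply: eq_bigr => i _; rewrite mulrC. Qed.

Lemma dotDl x y u : dot (x + y) u = dot x u + dot y u.
Proof. by rewrite /dot mulmxDl mxE. Qed.

Lemma dotNl x u : dot (- x) u = - dot x u.
Proof. by rewrite /dot mulNmx mxE. Qed.

Lemma dotBl x y u : dot (x - y) u = dot x u - dot y u.
Proof. by rewrite dotDl dotNl. Qed.

Lemma dotZl a x u : dot (a *: x) u = a * dot x u.
Proof. by rewrite /dot -scalemxAl mxE. Qed.

Lemma dot0l u : dot 0 u = 0.
Proof. by rewrite /dot mul0mx mxE. Qed.

Lemma dotNr x u : dot x (- u) = - dot x u.
Proof. by rewrite dotC dotNl dotC. Qed.

Lemma dotBr x u v : dot x (u - v) = dot x u - dot x v.
Proof. by rewrite !(dotC x) dotBl. Qed.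

Lemma dotZr a x u : dot x (a *: u) = a * dot x u.
Proof. by rewrite !(dotC x) dotZl. Qed.

Lemma dot0r x : dot x 0 = 0.
Proof. by rewrite dotC dot0l. Qed.

Lemma dotrr_ge0 x : 0 <= dot x x.
Proof. by rewrite dotE sumr_ge0 // => i _; rewrite -expr2 sqr_ge0. Qed.

Lemma dotrr_gt0 x : x != 0 -> 0 < dot x x.
Proof.
move=> x0; rewrite lt_neqAle dotrr_ge0 andbT eq_sym; apply: contra x0.
rewrite dotE psumr_eq0 => [/allP h|i _]; last by rewrite -expr2 sqr_ge0.
apply/eqP/rowP => i; rewrite mxE; apply/eqP.
by have := h i (mem_index_enum i); rewrite -expr2 sqrf_eq0.
Qed.

Lemma coord_le_norm x i : `|x 0 i| <= `|x|.
Proof.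
rewrite [leRHS]/Num.Def.normr /= mx_normrE.
by apply: (le_bigmax _ (fun ij => `|x ij.1 ij.2|) (0, i)).
Qed.

Lemma norm_leP x (M : R) : 0 <= M -> (forall i, `|x 0 i| <= M) -> `|x| <= M.
Proof.
move=> M0 xM; rewrite [leLHS]/Num.Def.normr /= mx_normrE.
by apply: bigmax_le => // -[i j] _ /=; rewrite (ord1 i).
Qed.

Lemma norm_ltP x (M : R) : 0 < M -> (forall i, `|x 0 i| < M) -> `|x| < M.
Proof.
move=> M0 xM; rewrite [ltLHS]/Num.Def.normr /= mx_normrE.
by apply: bigmax_lt => // -[i j] _ /=; rewrite (ord1 i).
Qed.

Lemma dot_le_norm x u : `|dot x u| <= n%:R * `|x| * `|u|.
Proof.
rewrite dotE (le_trans (ler_norm_sum _ _ _)) //.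
rewrite (le_trans (ler_sum (G := fun=> `|x| * `|u|) _ _)) //.
  by move=> i _; rewrite normrM ler_pM // coord_le_norm.
by rewrite sumr_const card_ord -[leLHS]mulr_natl mulrA.
Qed.

(* The extra 1 makes the constant positive even for u = 0 or n = 0. *)
Lemma dot_bound u : exists2 C : R, 0 < C & forall x, `|dot x u| <= C * `|x|.
Proof.
exists (n%:R * `|u| + 1) => [|x].
  by rewrite ltr_wpDl // mulr_ge0.
rewrite (le_trans (dot_le_norm _ _)) // mulrDl mul1r.
by rewrite mulrAC ler_wpDr.
Qed.

End Dot.

Lemma linear_bound (R : realType) n m (f : {linear 'rV[R]_n -> 'rV[R]_m}) :
  exists2 C : R, 0 < C & forall x, `|f x| <= C * `|x|.
Proof.
exists (\sum_i `|f (delta_mx 0 i)| + 1) => [|x].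
  by rewrite ltr_wpDl // sumr_ge0.
rewrite {1}(row_sum_delta x) linear_sum (le_trans (ler_norm_sum _ _ _)) //.
rewrite mulrDl mul1r ler_wpDr // mulr_suml ler_sum // => i _.
by rewrite linearZ /= normrZ mulrC ler_wpM2l // coord_le_norm.
Qed.

(** * Compactness *)

Lemma closed_norm_le (R : realType) n (p : 'rV[R]_n) (M : R) :
  closed [set x | `|x - p| <= M].
Proof.
apply/closed_normP => x Bx; apply/ler_addgt0Pr => e e0.
have [y /= yM yx] := Bx e e0.
have -> : x - p = (y - p) - (y - x) by rewrite opprB [RHS]addrC addrA subrK.
by rewrite (le_trans (ler_normB _ _)) // lerD // ltW.
Qed.

Lemma bounded_norm_le (R : realType) n (p : 'rV[R]_n) (M : R) A :
  (forall x, A x -> `|x - p| <= M) -> bounded_set A.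
Proof.
move=> AM; exists (M + `|p|); split; first exact: num_real.
move=> N MN x /= /AM xM; rewrite -[x](subrK p) (le_trans (ler_normD _ _)) //.
by rewrite (le_trans _ (ltW MN)) // lerD2r.
Qed.

(** The sets D e shrink with e and generate a proper filter on a compact ball, so this filter
    clusters at some u. Limit directions are obtained this way without choosing sequences. *)
Lemma cluster_point (R : realType) n (M : R) (D : R -> set 'rV[R]_n) :
  (forall e, 0 < e -> D e !=set0) ->
  (forall e x, 0 < e -> D e x -> `|x| <= M) ->
  (forall e e' x, 0 < e -> e <= e' -> D e x -> D e' x) ->
  exists u, forall e, 0 < e -> exists2 x, D e x & `|x - u| < e.
Proof.
move=> Dne DM Dmon.
pose B := [set x : 'rV[R]_n | `|x - 0| <= M].
have cB : compact B.
  apply: bounded_closed_compact; last exact: closed_norm_le.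
  exact: (@bounded_norm_le _ _ 0 M).
pose F := filter_from [set e : R | 0 < e] D.
have FF : Filter F.
  apply: filter_from_filter; first by exists 1 => /=.
  move=> i j /= i0 j0; exists (Num.min i j); first by rewrite /= lt_min i0.
  move=> x /= h; split; (apply: Dmon h; first by rewrite lt_min i0);
    by rewrite ge_min lexx ?orbT.
have PF : ProperFilter F.
  by apply: filter_from_proper.
have FB : F B by exists 1 => //= x; rewrite /B /= subr0; apply: DM.
have [u [_ clu]] := cB F PF FB.
exists u => e e0.
have [|x [xD xu]] := clu (D e) (ball u e) _ (nbhsx_ballx u e e0).
  by exists e.
by exists x => //; move: xu; rewrite -ball_normE /ball_ /= distrC.
Qed.
(** * Subspaces and affine hulls *)

(** The idempotent with kernel V: it models the quotient by V inside the same space. *)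
Definition coproj (R : realType) n (V : {vspace 'rV[R]_n}) :
  'End('rV[R]_n) := (\1 - projv V)%VF.

Section Coproj.
Variables (R : realType) (n : nat) (V : {vspace 'rV[R]_n}).
Implicit Types x v : 'rV[R]_n.

Lemma coprojE x : coproj V x = x - projv V x.
Proof. by rewrite /coproj add_lfunE opp_lfunE id_lfunE. Qed.

Lemma sub_coproj x : x - coproj V x \in V.
Proof. by rewrite coprojE opprB addrC subrK memv_proj. Qed.

Lemma coproj_eq0 x : (coproj V x == 0) = (x \in V).
Proof.
apply/idP/idP => [/eqP x0|xV]; last by rewrite coprojE projv_id // subrr.
by have := sub_coproj x; rewrite x0 subr0.
Qed.

Lemma coproj0 v : v \in V -> coproj V v = 0.
Proof. by rewrite -coproj_eq0 => /eqP. Qed.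

Lemma coproj_id x : coproj V (coproj V x) = coproj V x.
Proof.
apply/eqP; rewrite -subr_eq0 -linearB /= coproj_eq0 -opprB memvN.
exact: sub_coproj.
Qed.

Lemma coproj_bound : exists2 C : R, 0 < C & forall x, `|coproj V x| <= C * `|x|.
Proof. exact: (linear_bound (coproj V)). Qed.

End Coproj.

Lemma dim_rV (R : realType) n : \dim {: 'rV[R]_n} = n.
Proof. by rewrite dimvf; exact: mul1n. Qed.

Lemma dim_rV_le (R : realType) n (V : {vspace 'rV[R]_n}) : (\dim V <= n)%N.
Proof. by rewrite -[leqRHS](dim_rV R n); apply: dimvS; exact: subvf. Qed.

Lemma dim_rV_full (R : realType) n (V : {vspace 'rV[R]_n}) :
  \dim V = n -> V = fullv.
Proof.
move=> dV; apply/eqP; rewrite eqEdim subvf /=.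
by rewrite dim_rV dV.
Qed.

Lemma exists_max_dim (R : realType) n (P : {vspace 'rV[R]_n} -> Prop) V0 :
  P V0 -> exists2 V, P V & forall W, P W -> (\dim W <= \dim V)%N.
Proof.
move=> PV0.
pose Q d := `[< exists2 V, P V & \dim V = d >].
have Qex : exists d, Q d by exists (\dim V0); apply/asboolP; exists V0.
have Qub d : Q d -> (d <= n)%N by move=> /asboolP[V _ <-]; exact: dim_rV_le.
case: (ex_maxnP Qex Qub) => d /asboolP[V PV <-] dmax.
by exists V => // W PW; apply: dmax; apply/asboolP; exists W.
Qed.

Lemma dim_addv_line (R : realType) n (V : {vspace 'rV[R]_n}) x :
  x \notin V -> (\dim V < \dim (V + <[x]>))%N.
Proof.
apply: contraR; rewrite -leqNgt => dV.
have /eqP -> : V == (V + <[x]>)%VS by rewrite eqEdim addvSl.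
by rewrite memvE addvSr.
Qed.

(** Among the subspaces contained in D take one of maximal dimension; a point of D outside it would
    enlarge it. *)
Lemma subspaceP (R : realType) n (D : set 'rV[R]_n) :
  D 0 -> (forall a x y, D x -> D y -> D (a *: x + y)) ->
  exists V : {vspace 'rV[R]_n}, forall x, D x <-> x \in V.
Proof.
move=> D0 Dlin.
have [|V VD Vmax] := @exists_max_dim R n
  (fun V => forall x, x \in V -> D x) 0%VS.
  by move=> x; rewrite memv0 => /eqP ->.
exists V => x; split=> [Dx|]; last exact: VD.
apply: contraT => /dim_addv_line; rewrite ltnNge => /negP[]; apply: Vmax => y.
move=> /memv_addP[v vV [_ /vlineP[k ->] ->]].
by rewrite addrC; apply: Dlin => //; apply: VD.
Qed.

(** A ball relative to the flat a + V; S itself may leave that flat. *)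
Definition ball_in (R : realType) n (S : set 'rV[R]_n) a
    (V : {vspace 'rV[R]_n}) (e : R) :=
  forall y, y - a \in V -> `|y - a| < e -> S y.

(** Take V of maximal dimension such that S contains a relative ball. If some x in S had x - a
    outside V, the convex hull of x and this ball would contain a ball of one dimension more. *)
Lemma convex_relint (R : realType) n (S : set 'rV[R]_n) x0 :
  convex_set S -> S x0 ->
  exists (a : 'rV[R]_n) (V : {vspace 'rV[R]_n}) (e : R),
    [/\ 0 < e, forall x, S x -> x - a \in V & ball_in S a V e].
Proof.
move=> /convex_setP cS Sx0.
have [|V [a [e [e0 aV]]] Vmax] := @exists_max_dim R n
  (fun V => exists (a : 'rV[R]_n) (e : R), 0 < e /\ ball_in S a V e) 0%VS.
  exists x0, 1; split=> // y; rewrite memv0 subr_eq0 => /eqP ->.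
  by rewrite subrr normr0.
exists a, V, e; split=> // x Sx.
apply: contraT => xaV; have := dim_addv_line xaV.
rewrite ltnNge => /negP[]; apply: Vmax.
have Sa : S a by apply: aV; rewrite subrr ?mem0v ?normr0.
set w := x - a in xaV *.
have [C C0 bC] := coproj_bound V.
have h0 : 0 < `|coproj V w| by rewrite normr_gt0 coproj_eq0.
set h := `|coproj V w| in h0.
pose D := 1 + C * `|w| / h.
have D0 : 0 < D.
  by rewrite ltr_pwDl // !mulr_ge0 ?invr_ge0 // ltW.
(* The new centre is the midpoint of a and x. For a displacement v + s w with v in V, the first
   bound on the radius gives |s| <= 1/4 and the second gives |v| < e/4. Hence the weight t = 1/2 + s
   of x leaves 1 - t >= 1/4, and v / (1 - t) stays in the ball of radius e. *)
exists (a + 2^-1 *: w), (Num.min (h / (4 * C)) (e / (4 * D))); split.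
  by rewrite lt_min !divr_gt0 ?mulr_gt0.
move=> y; set d := y - _ => /memv_addP[v vV [_ /vlineP[s ->] dE]].
rewrite lt_min => /andP[d1 d2].
have sh : `|s| * h <= C * `|d|.
  rewrite (le_trans _ (bC d)) // dE linearD /= (coproj0 vV) add0r linearZ /=.
  by rewrite normrZ.
have s4 : `|s| <= 4^-1.
  rewrite -(ler_pM2r h0) (le_trans sh) // ltW //.
  by move: d1; rewrite ltr_pdivlMr ?mulr_gt0 // mulrA; lra.
have vn : `|v| < e / 4.
  have -> : v = d - s *: w by rewrite dE addrK.
  rewrite (le_lt_trans (ler_normB _ _)) // normrZ.
  apply: (@le_lt_trans _ _ (`|d| * D)).
    rewrite /D mulrDr mulr1 lerD2l.
    have -> : `|d| * (C * `|w| / h) = (C * `|d| / h) * `|w| by ring.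
    by rewrite ler_wpM2r // ler_pdivlMr.
  rewrite ltr_pdivlMr // -mulrA (mulrC D) -ltr_pdivlMr //.
  by rewrite mulr_gt0.
pose t := 2^-1 + s.
have : - 4^-1 <= s <= 4^-1 by rewrite -ler_norml.
move=> /andP[s1 s2].
have t0 : 0 <= t by rewrite /t; lra.
have t1 : 0 < 1 - t by rewrite /t; lra.
have -> : y = (1 - t) *: (a + (1 - t)^-1 *: v) + t *: x.
  rewrite scalerDr scalerA mulfV ?gt_eqF // scale1r.
  have -> : x = a + w by rewrite /w addrC subrK.
  have -> : y = a + 2^-1 *: w + d by rewrite /d addrC subrK.
  rewrite dE /t; apply/rowP => i; rewrite !mxE; ring.
apply: cS => //; first by rewrite -subr_ge0 ltW.
apply: aV; rewrite addrC addKr; first exact: memvZ.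
rewrite normrZ gtr0_norm ?invr_gt0 // mulrC ltr_pdivrMr //.
apply: (lt_le_trans vn); apply: ler_wpM2l; first exact: ltW.
by rewrite /t; lra.
Qed.

Lemma minkowski_point (R : realType) n (a : 'rV[R]_n)
    (V : {vspace 'rV[R]_n}) x :
  minkowski_sum [set a] [set` V] x <-> x - a \in V.
Proof.
split=> [[_ -> [v /= vV <-]]|xV]; first by rewrite addrC addKr.
by exists a => //; exists (x - a) => //; rewrite addrC subrK.
Qed.

Lemma affine_hull_sub (R : realType) n (S : set 'rV[R]_n) a
    (V : {vspace 'rV[R]_n}) :
  (forall x, S x -> x - a \in V) -> forall x, affine_hull S x -> x - a \in V.
Proof.
move=> SV x [k [p [c [Sp c1 ->]]]].
have -> : \sum_i c i *: p i - a = \sum_i c i *: (p i - a).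
  under [RHS]eq_bigr do rewrite scalerBr.
  by rewrite sumrB -scaler_suml c1 scale1r.
by apply: memv_suml => i _; apply: memvZ; apply: SV.
Qed.

Lemma affine_hull2 (R : realType) n (S : set 'rV[R]_n) x y (t : R) :
  S x -> S y -> affine_hull S ((1 - t) *: x + t *: y).
Proof.
move=> Sx Sy.
exists 2, (fun i => if i == 0 then x else y), (fun i => if i == 0 then 1 - t else t).
split=> [i||]; first by case: ifP.
  by rewrite !big_ord_recl big_ord0 /= addr0 subrK.
by rewrite !big_ord_recl big_ord0 /= addr0.
Qed.

(** Each point of a + V lies on the line through a and a point of the ball, so combinations of two
    points suffice. *)
Lemma affine_hullE (R : realType) n (S : set 'rV[R]_n) a
    (V : {vspace 'rV[R]_n}) e :
  0 < e -> (forall x, S x -> x - a \in V) -> ball_in S a V e ->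
  affine_hull S = minkowski_sum [set a] [set` V].
Proof.
move=> e0 SV aV; apply/seteqP; split=> x.
  by move=> /(affine_hull_sub SV) xV; apply/minkowski_point.
move=> /minkowski_point xV.
pose s := e / (2 * (`|x - a| + 1)).
have x1 : 0 < `|x - a| + 1 by rewrite ltr_wpDl.
have s0 : 0 < s by rewrite divr_gt0 ?mulr_gt0.
have -> : x = (1 - s^-1) *: a + s^-1 *: (a + s *: (x - a)).
  rewrite scalerDr scalerA mulVf ?gt_eqF // scale1r.
  by apply/rowP => i; rewrite !mxE; ring.
apply: affine_hull2; apply: aV; rewrite ?subrr ?mem0v ?normr0 //.
  by rewrite addrC addKr memvZ.
rewrite addrC addKr normrZ gtr0_norm // /s mulrAC ltr_pdivrMr ?mulr_gt0 //.
by rewrite ltr_pM2l //; lra.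
Qed.

Lemma minkowski_point_inj (R : realType) n (a b : 'rV[R]_n)
    (V W : {vspace 'rV[R]_n}) :
  minkowski_sum [set a] [set` V] = minkowski_sum [set b] [set` W] -> V = W.
Proof.
move=> E; apply/vspaceP => v.
have P x : (x - a \in V) = (x - b \in W).
  by apply/idP/idP => /minkowski_point h; apply/minkowski_point; rewrite (E, =^~ E).
have abW : a - b \in W by rewrite -P subrr mem0v.
have := P (a + v); rewrite addrC addKr => ->.
by rewrite addrAC rpredDl.
Qed.

(** A relative ball pins the hull down to a + V, whose direction is unique; dimensions are computed
    through this equivalence. *)
Lemma has_dimP (R : realType) n (S : set 'rV[R]_n) a
    (V : {vspace 'rV[R]_n}) e d :
  0 < e -> (forall x, S x -> x - a \in V) -> ball_in S a V e ->
  has_dim S d <-> \dim V = d.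
Proof.
move=> e0 SV aV; have E := affine_hullE e0 SV aV; split=> [|<-].
  by move=> [b [W [EW <-]]]; rewrite (@minkowski_point_inj _ _ a b V W) // -E.
by exists a, V.
Qed.
Lemma le0_mul_eps (R : realFieldType) (a C : R) :
  0 <= C -> (forall e, 0 < e -> a <= C * e) -> a <= 0.
Proof.
move=> C0 aC; rewrite leNgt; apply/negP => a0.
have C1 : 0 < 2 * (C + 1) by rewrite mulr_gt0 // ltr_wpDl.
have := aC (a / (2 * (C + 1))); rewrite divr_gt0 // => /(_ isT).
apply/negP; rewrite -ltNge mulrA ltr_pdivrMr //; nra.
Qed.

(** * Separation *)

Lemma continuous_dotrr (R : realType) n (p : 'rV[R]_n) :
  continuous (fun x : 'rV[R]_n => dot (x - p) (x - p)).
Proof.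
rewrite (_ : (fun x => _) =
    (fun x : 'rV[R]_n => \sum_i (x 0 i - p 0 i) * (x 0 i - p 0 i))); last first.
  by apply/funext => y; rewrite dotE; apply: eq_bigr => i _; rewrite !mxE.
apply: (@continuous_big R^o 'I_n +%R 0 xpredT _ 'rV[R]_n _
  (fun i x => (x 0 i - p 0 i) * (x 0 i - p 0 i))) => [|i _ x].
  exact: add_continuous.
have cB : {for x, continuous (fun y : 'rV[R]_n => y 0 i - p 0 i)}.
  apply: (@continuousB R R^o _ (fun y : 'rV[R]_n => y 0 i) (cst (p 0 i))).
    exact: coord_continuous.
  exact: cst_continuous.
exact: (continuousM cB cB).
Qed.

(** Compares the maximum norm with the squared Euclidean length, so that points at bounded Euclidean
    distance form a bounded set. *)
Lemma norm_le_dotrr (R : realType) n (y : 'rV[R]_n) : `|y| <= dot y y + 1.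
Proof.
apply: norm_leP => [|i]; first by rewrite addr_ge0 ?dotrr_ge0.
have : y 0 i ^+ 2 <= dot y y.
  rewrite dotE (bigD1 i) //= -expr2 lerDl sumr_ge0 // => j _.
  by rewrite -expr2 sqr_ge0.
rewrite -real_normK ?num_real //; have := normr_ge0 (y 0 i); nra.
Qed.

(* The separating direction points from the nearest point of K to p. *)
Lemma strict_separation (R : realType) n (K : set 'rV[R]_n) p :
  closed K -> convex_set K -> ~ K p ->
  exists u, forall x, K x -> dot x u < dot p u.
Proof.
move=> cK /convex_setP vK Kp.
have [[x0 Kx0]|K0] := pselect (K !=set0); last first.
  by exists 0 => x Kx; case: K0; exists x.
pose f x := dot (x - p) (x - p).
(* A compact piece of K that contains every point at least as close to p as x0, hence a nearest
   point of K. *)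
pose A := K `&` [set x | `|x - p| <= f x0 + 1].
have [|||c /set_mem[Kc _] cmin] := @EVT_min_rV R n f A.
- by exists x0; split=> //=; exact: norm_le_dotrr.
- apply: bounded_closed_compact; last by apply: closedI => //; exact: closed_norm_le.
  by apply: (@bounded_norm_le _ _ p (f x0 + 1)) => x [].
- by apply: continuous_subspaceT; exact: continuous_dotrr.
have {}cmin x : K x -> f c <= f x.
  move=> Kx; have [xx0|/ltW xx0] := leP (f x) (f x0).
    apply: cmin; apply/mem_set; split=> //=.
    by rewrite (le_trans (norm_le_dotrr _)) // lerD2r.
  apply: le_trans xx0; apply: cmin; apply/mem_set; split=> //=.
  exact: norm_le_dotrr.
have cp : p - c != 0 by apply: contra_notN Kp => /eqP/subr0_eq ->.
exists (p - c) => x Kx; rewrite -subr_gt0 -dotBl.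
have -> : p - x = (p - c) - (x - c) by rewrite opprB addrA subrK.
rewrite dotBl; suff : dot (x - c) (p - c) <= 0.
  by have := dotrr_gt0 cp; lra.
rewrite leNgt; apply/negP => s0.
set s := dot _ _ in s0.
set B := dot (x - c) (x - c).
have B0 : 0 <= B by exact: dotrr_ge0.
have sB : 0 < s + B by lra.
(* Moving from c towards x by t changes the squared distance to p by t (t B - 2 s), which is
   negative for this t. *)
pose t := s / (s + B).
have t0 : 0 < t by rewrite divr_gt0.
have t1 : t <= 1 by rewrite ler_pdivrMr // mul1r; lra.
have := cmin _ (vK _ _ _ (ltW t0) t1 Kc Kx); rewrite /f.
have -> : (1 - t) *: c + t *: x - p = t *: (x - c) - (p - c).
  by apply/rowP => i; rewrite !mxE; ring.
have -> : c - p = - (p - c) by rewrite opprB.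
have tsB : t * (s + B) = s by rewrite /t divfK // gt_eqF.
clearbody t.
move: @s @B B0 sB s0 t0 t1 tsB.
move: (x - c) (p - c) => a b s B B0 sB s0 t0 t1 tsB.
rewrite dotNl dotNr opprK dotBl !dotBr !dotZl !dotZr (dotC b a) -/s -/B.
nra.
Qed.

(** Points q outside K and arbitrarily near p are strictly separated from K; the normalized
    functionals cluster at some u, and the inequality passes to the limit. *)
Lemma supporting_functional (R : realType) n (K : set 'rV[R]_n) p :
  closed K -> convex_set K -> K !=set0 -> ~ K° p ->
  exists2 u, u != 0 & forall x, K x -> dot x u <= dot p u.
Proof.
move=> cK vK [x0 Kx0] Kp.
pose D (e : R) := [set u : 'rV[R]_n | `|u| = 1 /\
  exists2 q, `|q - p| < e & forall x, K x -> dot x u <= dot q u].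
have [e e0|e u _ [u1 _]|e e' u _ ee' [u1 [q qp qu]]|u uP] := @cluster_point R n 1 D.
- have [q qp Kq] : exists2 q, `|q - p| < e & ~ K q.
    apply: contrapT => h; apply: Kp; apply/interior_normP; exists e => // y yp.
    by apply: contrapT => Ky; apply: h; exists y.
  have [u uK] := strict_separation cK vK Kq.
  have u0 : u != 0.
    by apply/eqP => u0; have := uK _ Kx0; rewrite u0 !dot0r ltxx.
  have u0' : 0 < `|u|^-1 by rewrite invr_gt0 normr_gt0.
  exists (`|u|^-1 *: u); split.
    by rewrite normrZ gtr0_norm // mulVf // normr_eq0.
  exists q => // x Kx; rewrite !dotZr ler_pM2l //; exact/ltW/uK.
- by rewrite u1.
- by split=> //; exists q => //; apply: lt_le_trans ee'.
exists u.
  apply/eqP => u0; have [v [v1 _]] := uP 1 ltr01.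
  by rewrite u0 subr0 v1 ltxx.
move=> x Kx; rewrite -subr_le0 -dotBl.
apply: (@le0_mul_eps _ _ (n%:R * `|x - p| + n%:R)).
  by rewrite addr_ge0 // mulr_ge0.
move=> e e0; have [v [v1 [q qp qv]] vu] := uP e e0.
have -> : dot (x - p) u = dot (x - p) v + dot (x - p) (u - v).
  by rewrite dotBr [RHS]addrC subrK.
have h1 : dot (x - p) v <= n%:R * e.
  have -> : x - p = (x - q) + (q - p) by rewrite addrA subrK.
  rewrite dotDl; have := qv x Kx; rewrite -subr_le0 -dotBl => h.
  have := dot_le_norm (q - p) v; rewrite v1 mulr1 => h'.
  have := ler_norm (dot (q - p) v).
  have : n%:R * `|q - p| <= n%:R * e by rewrite ler_wpM2l // ltW.
  lra.
have h2 : dot (x - p) (u - v) <= n%:R * `|x - p| * e.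
  rewrite (le_trans (ler_norm _)) // (le_trans (dot_le_norm _ _)) //.
  by rewrite ler_wpM2l ?mulr_ge0 // distrC ltW.
rewrite mulrDl; lra.
Qed.

(** * Integer points *)

(** Cut the cube of radius M into N boxes of side d: two of any N + 1 points in it share a box. N
    does not depend on g. *)
Lemma pigeonhole_norm (R : realType) n (M d : R) : 0 < d ->
  exists N : nat, forall g : nat -> 'rV[R]_n,
    (forall i, (i <= N)%N -> `|g i| <= M) ->
    exists i j, [/\ (i < j)%N, (j <= N)%N & `|g i - g j| < d].
Proof.
move=> d0; pose B := Num.truncn ((M + M) / d).
pose N := #|{ffun 'I_n -> 'I_B.+1}|; exists N => g gM.
pose c (i : 'I_N.+1) : {ffun 'I_n -> 'I_B.+1} :=
  [ffun k => inord (Num.truncn ((g i 0 k + M) / d))].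
have [i [j [ij cij]]] : exists i j, i != j /\ c i = c j.
  have [/injectiveP/leq_card|/injectivePn[i [j ij cij]]] := boolP (injectiveb c).
    by rewrite card_ord ltnn.
  by exists i, j.
have key (a b : 'I_N.+1) : c a = c b -> `|g a - g b| < d.
  move=> cab; apply: norm_ltP => // k; rewrite !mxE.
  have ge0 (a' : 'I_N.+1) : 0 <= (g a' 0 k + M) / d /\ (g a' 0 k + M) / d <= (M + M) / d.
    have := gM a' (leq_ord a'); move/(le_trans (coord_le_norm _ k)).
    rewrite ler_norml => /andP[h1 h2]; split.
      by apply: divr_ge0; [lra | exact: ltW].
    by rewrite ler_pM2r ?invr_gt0 //; lra.
  have [a0 aB] := ge0 a; have [b0 bB] := ge0 b.
  have /(congr1 val) := congr1 (fun f : {ffun _ -> _} => f k) cab.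
  rewrite !ffunE /= !inordK ?ltnS; [move=> E | exact: le_truncn | exact: le_truncn].
  have /andP[ha ha'] := truncn_itv a0; have /andP[hb hb'] := truncn_itv b0.
  rewrite E in ha ha'.
  rewrite -(ltr_pM2r (_ : 0 < d^-1)) ?invr_gt0 // mulfV ?gt_eqF //.
  rewrite -[X in _ * X](@gtr0_norm _ d^-1) ?invr_gt0 // -normrM.
  move: ha ha' hb hb'; rewrite -natr1 !(mulrDl _ M) => ha ha' hb hb'.
  by rewrite mulrBl ltr_norml; apply/andP; split; lra.
move: ij; rewrite neq_ltn => /orP[ij|ij].
  by exists i, j; split; [|exact: leq_ord|exact: key].
by exists j, i; split; [|exact: leq_ord|exact: key].
Qed.

Lemma integer_point0 (R : realType) n : integer_points (0 : 'rV[R]_n).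
Proof. by apply/mxOverP => i j; rewrite mxE. Qed.

Lemma integer_pointD (R : realType) n (x y : 'rV[R]_n) :
  integer_points x -> integer_points y -> integer_points (x + y).
Proof.
by move=> /mxOverP xZ /mxOverP yZ; apply/mxOverP => i j; rewrite mxE rpredD.
Qed.

Lemma integer_pointN (R : realType) n (x : 'rV[R]_n) :
  integer_points x -> integer_points (- x).
Proof. by move=> /mxOverP xZ; apply/mxOverP => i j; rewrite mxE rpredN. Qed.

Lemma integer_pointB (R : realType) n (x y : 'rV[R]_n) :
  integer_points x -> integer_points y -> integer_points (x - y).
Proof. by move=> ? ?; apply: integer_pointD => //; apply: integer_pointN. Qed.

Lemma integer_pointZ (R : realType) n (m : int) (x : 'rV[R]_n) :
  integer_points x -> integer_points (m%:~R *: x).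
Proof.
by move=> /mxOverP xZ; apply/mxOverP => i j; rewrite mxE rpredM // intr_int.
Qed.

Definition floor_rV (R : realType) n (x : 'rV[R]_n) : 'rV[R]_n :=
  \row_i (Num.floor (x 0 i))%:~R.

Lemma integer_floor_rV (R : realType) n (x : 'rV[R]_n) :
  integer_points (floor_rV x).
Proof. by apply/mxOverP => i j; rewrite !mxE intr_int. Qed.

Lemma sub_floor_rV_le1 (R : realType) n (x : 'rV[R]_n) : `|x - floor_rV x| <= 1.
Proof.
apply: norm_leP => // i; rewrite !mxE.
have /andP[] := floor_itv (x 0 i); rewrite intrD => h1 h2.
by rewrite ger0_norm ?subr_ge0 //; lra.
Qed.

(** Two of the fractional parts of the multiples i v are within e of each other; m is the difference
    of their indices and w that of their integer parts. *)
Lemma dirichlet (R : realType) n (v : 'rV[R]_n) (e : R) : 0 < e ->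
  exists m w, [/\ (0 < m)%N, integer_points w & `|m%:R *: v - w| < e].
Proof.
move=> /(@pigeonhole_norm _ n 1)[N].
move=> /(_ (fun i => i%:R *: v - floor_rV (i%:R *: v)))[i _|i [j [ij _ gij]]].
  exact: sub_floor_rV_le1.
exists (j - i)%N, (floor_rV (j%:R *: v) - floor_rV (i%:R *: v)); split.
- by rewrite subn_gt0.
- by apply: integer_pointB; exact: integer_floor_rV.
rewrite distrC; apply: le_lt_trans gij; rewrite natrB; last exact: ltnW.
rewrite scalerBl le_eqVlt; apply/orP; left; apply/eqP; congr `|_|.
by apply/rowP => k; rewrite !mxE; ring.
Qed.

(** The values of h on S are bounded and d-separated, hence finite in number. A longest list with
    distinct values represents them all. *)
Lemma finite_representatives (R : realType) n (S : set 'rV[R]_n)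
    (h : 'rV[R]_n -> 'rV[R]_n) (M d : R) :
  0 < d -> (forall x, S x -> `|h x| <= M) ->
  (forall x y, S x -> S y -> `|h x - h y| < d -> h x = h y) ->
  exists s : seq 'rV[R]_n, (forall x, x \in s -> S x) /\
    forall x, S x -> exists2 y, y \in s & h x = h y.
Proof.
move=> d0 hM hsep; have [N NP] := @pigeonhole_norm R n M d d0.
pose Q k := `[< exists s : seq 'rV[R]_n,
  [/\ size s = k, uniq (map h s) & forall x, x \in s -> S x] >].
have Q0 : exists k, Q k by exists 0%N; apply/asboolP; exists [::].
have QN k : Q k -> (k <= N)%N.
  move=> /asboolP[s [<- us sS]]; rewrite leqNgt; apply/negP => Ns.
  have sP i : (i <= N)%N -> S (nth 0 s i).
    by move=> iN; apply/sS/mem_nth/(leq_ltn_trans iN).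
  have [i iN|i [j [ij jN]]] := NP (fun i => h (nth 0 s i)).
    exact/hM/sP.
  have iN := leq_trans (ltnW ij) jN.
  move=> /(hsep _ _ (sP _ iN) (sP _ jN)) E.
  have := @nth_uniq _ (h 0) (map h s) i j; rewrite size_map.
  rewrite !(nth_map 0) ?(leq_ltn_trans _ Ns) // => /(_ isT isT us).
  by rewrite E eqxx (ltn_eqF ij).
case: (ex_maxnP Q0 QN) => k /asboolP[s [sk us sS]] kmax.
exists s; split=> // x Sx.
have [/mapP[y ys ->]|hx] := boolP (h x \in map h s); first by exists y.
have /kmax : Q k.+1; last by rewrite ltnn.
apply/asboolP; exists (x :: s); split; rewrite /= ?sk ?hx // => y.
by rewrite inE => /predU1P[->|/sS].
Qed.

(** * Closures and interiors of convex sets *)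

Lemma closure_normP (R : realType) n (A : set 'rV[R]_n) x :
  closure A x <-> forall e : R, 0 < e -> exists2 y, A y & `|y - x| < e.
Proof.
split=> [clx e e0|Ax B /nbhs_ballP[e /= e0 eB]].
  have [|y [Ay yx]] := clx (ball x e); first exact: nbhsx_ballx.
  by exists y => //; move: yx; rewrite -ball_normE /ball_ /= distrC.
have [y Ay yx] := Ax e e0; exists y; split=> //; apply: eB.
by rewrite -ball_normE /ball_ /= distrC.
Qed.

Lemma convex_closure (R : realType) n (A : set 'rV[R]_n) :
  convex_set A -> convex_set (closure A).
Proof.
move=> /convex_setP cA; apply/convex_setP => x y t t0 t1.
move=> /closure_normP Ax /closure_normP Ay; apply/closure_normP => e e0.
have [x' Ax' xx'] := Ax e e0; have [y' Ay' yy'] := Ay e e0.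
exists ((1 - t) *: x' + t *: y'); first exact: cA.
have -> : (1 - t) *: x' + t *: y' - ((1 - t) *: x + t *: y) =
    (1 - t) *: (x' - x) + t *: (y' - y).
  by apply/rowP => i; rewrite !mxE; ring.
rewrite (le_lt_trans (ler_normD _ _)) // !normrZ !ger0_norm ?subr_ge0 //.
move: xx' yy'; set a := `|x' - x|; set b := `|y' - y|; have [?|?] := leP a b; nra.
Qed.

Lemma interior_near (R : realType) n (A : set 'rV[R]_n) x e y :
  (forall y, `|y - x| < e -> A y) -> `|y - x| < e -> A° y.
Proof.
move=> xA yx; apply/interior_normP; exists (e - `|y - x|); first by rewrite subr_gt0.
move=> z zy; apply: xA; rewrite -(subrK y z) -addrA.
by rewrite (le_lt_trans (ler_normD _ _)) // -ltrBrDr.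
Qed.

(** The homothety with centre y and ratio 1 - t carries the ball around x to a ball around the new
    point. *)
Lemma convex_interior (R : realType) n (A : set 'rV[R]_n) x y (t : R) :
  convex_set A -> A° x -> A y -> 0 <= t < 1 -> A° ((1 - t) *: x + t *: y).
Proof.
move=> /convex_setP cA /interior_normP[e e0 xA] Ay /andP[t0 t1].
have t1' : 0 < 1 - t by rewrite subr_gt0.
apply/interior_normP; exists ((1 - t) * e); first exact: mulr_gt0.
move=> z zx; pose w := x + (1 - t)^-1 *: (z - ((1 - t) *: x + t *: y)).
have -> : z = (1 - t) *: w + t *: y.
  rewrite /w scalerDr scalerA mulfV ?gt_eqF // scale1r.
  by apply/rowP => i; rewrite !mxE; ring.
apply: cA => //; first exact: ltW.
apply: xA; rewrite /w addrC addKr normrZ gtr0_norm ?invr_gt0 //.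
by rewrite ltr_pdivrMl.
Qed.

Lemma maximal_sub (R : realType) n (K K' : set 'rV[R]_n) :
  maximal_lattice_free K -> lattice_free K' -> K `<=` K' -> K' `<=` K.
Proof.
by move=> [_ mK] /mK KK' sK; apply: contrapT => nK; apply: KK'; split.
Qed.

Lemma lattice_freeP (R : realType) n (K : set 'rV[R]_n) z :
  lattice_free K -> integer_points z -> ~ K° z.
Proof.
by move=> [_ _ K0] zZ Kz; have : (K° `&` @integer_points R n) z by []; rewrite K0.
Qed.

(** * The lineality space of a maximal set *)

Definition lineality (R : realType) n (K : set 'rV[R]_n) : set 'rV[R]_n :=
  [set u | forall x t, K x -> K (x + t *: u)].

Lemma lineality_subspace (R : realType) n (K : set 'rV[R]_n) :
  exists L : {vspace 'rV[R]_n}, forall u, lineality K u <-> u \in L.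
Proof.
apply: subspaceP => [x t Kx|a u v Ku Kv x t Kx].
  by rewrite scaler0 addr0.
by rewrite scalerDr scalerA addrA; apply/Kv/Ku.
Qed.

Lemma interior_lineality (R : realType) n (K : set 'rV[R]_n) x u :
  lineality K u -> K° x -> K° (x + u).
Proof.
move=> Ku /interior_normP[e e0 xK]; apply/interior_normP; exists e => // y yx.
rewrite -[y](subrK u) -[X in _ + X]scale1r; apply/Ku/xK.
by rewrite -addrA -opprD (addrC u).
Qed.

Section Maximal.
Variables (R : realType) (n : nat) (K : set 'rV[R]_n) (x0 : 'rV[R]_n).
Hypotheses (mK : maximal_lattice_free K) (Kx0 : K° x0).

Let lfK : lattice_free K. Proof. by case: mK. Qed.
Let closedK : closed K. Proof. by case: lfK. Qed.
Let convexK : convex_set K. Proof. by case: lfK. Qed.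
Let nonemptyK : K x0. Proof. exact: interior_subset Kx0. Qed.

(* Otherwise the closure of K + R u would be a larger lattice-free set. *)
Lemma lineality_extension u :
  (forall z t, integer_points z -> ~ K° (z + t *: u)) -> lineality K u.
Proof.
move=> Ku; have cK := iffLR (convex_setP K) convexK.
pose C := [set y | exists x t, K x /\ y = x + t *: u].
have CK : closure C `<=` K; last first.
  move=> x t Kx; apply: CK; apply: subset_closure; by exists x, t.
apply: maximal_sub mK _ _; last first.
  by move=> x Kx; apply: subset_closure; exists x, 0; rewrite scale0r addr0.
split; first exact: closed_closure.
  apply: convex_closure; apply/convex_setP.
  move=> _ _ t t0 t1 [x [a [Kx ->]]] [y [b [Ky ->]]].
  exists ((1 - t) *: x + t *: y), ((1 - t) * a + t * b); split; first exact: cK.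
  by apply/rowP => i; rewrite !mxE; ring.
apply/seteqP; split=> // p [/interior_normP[e e0 pC] pZ].
have /interior_normP[e1 e10 xK] := Kx0.
(* Small enough that q, which lies beyond p on the ray from x0, is still within e of p. *)
pose eta := e / (2 * (`|p - x0| + 1)).
have px1 : 0 < `|p - x0| + 1 by rewrite ltr_wpDl.
have eta0 : 0 < eta by rewrite divr_gt0 ?mulr_gt0.
pose q := p + eta *: (p - x0).
have /pC/closure_normP : `|q - p| < e.
  rewrite /q addrC addKr normrZ gtr0_norm // /eta mulrAC ltr_pdivrMr ?mulr_gt0 //.
  by rewrite ltr_pM2l //; lra.
move=> /(_ (eta * e1)); rewrite mulr_gt0 // => /(_ isT).
move=> [_ [k [t [Kk ->]]] kq].
pose th := (1 + eta)^-1.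
have eta1 : 0 < 1 + eta by rewrite ltr_wpDl // ltW.
have th0 : 0 < th by rewrite invr_gt0.
have th1 : th < 1 by rewrite invf_lt1 // ltrDl.
have thE : th * (1 + eta) = 1 by rewrite mulVf // gt_eqF.
(* x1 absorbs the error between q and the nearby point k + t u, so that p = (1 - th) x1 + th (k + t
   u) exactly. Hence p - th t u is interior to K. *)
pose x1 := x0 + eta^-1 *: (q - (k + t *: u)).
have x1K : K° x1.
  apply: interior_near xK _; rewrite /x1 addrC addKr normrZ gtr0_norm ?invr_gt0 //.
  by rewrite distrC ltr_pdivrMl.
have xk : K° ((1 - th) *: x1 + th *: k).
  by apply: convex_interior; rewrite ?ltW.
clearbody th; have thE2 : th * eta = 1 - th by lra.
have thE3 : (1 - th) * eta^-1 = th by rewrite -thE2 mulfK // gt_eqF.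
apply: (Ku p (- th * t) pZ).
have <- // : (1 - th) *: x1 + th *: k = p + (- th * t) *: u.
rewrite /x1 scalerDr scalerA thE3 /q; clearbody eta.
apply/rowP => i; rewrite !mxE.
have -> : th * (p 0 i + eta * (p 0 i - x0 0 i) - (k 0 i + t * u 0 i)) =
  th * p 0 i + (th * eta) * (p 0 i - x0 0 i) - th * (k 0 i + t * u 0 i) by ring.
by rewrite thE2; ring.
Qed.

(** If z + t u were interior to K for an integer point z, moving forward along u would keep it
    interior and bring it close to another integer point. *)
Lemma recession_lineality u :
  (forall x t, K x -> 0 <= t -> K (x + t *: u)) -> lineality K u.
Proof.
move=> Ku; apply: lineality_extension => z t zZ /interior_normP[e e0 zK].
have e20 : 0 < e / 2 by rewrite divr_gt0.
(* The factor |t| + 1 gives m (|t| + 1) >= t for every m >= 1, so z + w is reached in the forward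
   direction. *)
have [m [w [m0 wZ mw]]] := dirichlet ((`|t| + 1) *: u) e20.
apply: (lattice_freeP lfK (integer_pointD zZ wZ)).
apply/interior_normP; exists (e / 2) => // y yz.
pose s := m%:R * (`|t| + 1) - t.
have s0 : 0 <= s.
  rewrite subr_ge0 (le_trans (ler_norm t)) //.
  have m1 : 1 <= m%:R :> R by rewrite ler1n.
  by have := normr_ge0 t; nra.
rewrite -[y](subrK (s *: u)); apply: Ku => //; apply: zK.
have -> : y - s *: u - (z + t *: u) =
    (y - (z + w)) - (m%:R *: ((`|t| + 1) *: u) - w).
  by rewrite /s; apply/rowP => i; rewrite !mxE; ring.
rewrite (le_lt_trans (ler_normB _ _)) //; lra.
Qed.

(** On the segment from y to a far point x of K, the point with parameter t / |x| tends to y + t u,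
    which lies in K by closedness. *)
Lemma recession_limit u :
  (forall e, 0 < e -> exists x, [/\ K x, 0 < `|x|, `|x|^-1 < e &
    `| `|x|^-1 *: x - u| < e]) ->
  lineality K u.
Proof.
move=> Ku; apply: recession_lineality => y t Ky t0.
have cK := iffLR (convex_setP K) convexK.
apply: (iffLR (closed_normP K) closedK) => e e0.
have D0 : 0 < (t + 1) * (`|y| + 2).
  by rewrite mulr_gt0 // ltr_wpDl.
pose d := e / ((t + 1) * (`|y| + 2)).
have d0 : 0 < d by rewrite divr_gt0.
have t10 : 0 < (t + 1)^-1 by rewrite invr_gt0 ltr_wpDl.
have [|x [Kx x0' xd xu]] := Ku (Num.min d (t + 1)^-1); first by rewrite lt_min d0.
move: xd xu; rewrite !lt_min => /andP[xd xt] /andP[xu _].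
pose s := t * `|x|^-1.
have s0 : 0 <= s by rewrite mulr_ge0 // invr_ge0.
have s1 : s <= 1.
  have : s <= t * (t + 1)^-1 by rewrite ler_wpM2l // ltW.
  by move=> /le_trans -> //; rewrite ler_pdivrMr ?mul1r ?lerDl // ltr_wpDl.
exists ((1 - s) *: y + s *: x); first exact: cK.
have -> : (1 - s) *: y + s *: x - (y + t *: u) =
    t *: ((`|x|^-1 *: x - u) - `|x|^-1 *: y).
  by rewrite /s; apply/rowP => i; rewrite !mxE; ring.
rewrite normrZ ger0_norm //.
have dE : d * ((t + 1) * (`|y| + 2)) = e by rewrite divfK // gt_eqF.
have yd : `| `|x|^-1 *: y| <= d * `|y|.
  by rewrite normrZ ger0_norm ?invr_ge0 // ler_wpM2r // ltW.
have := ler_normB (`|x|^-1 *: x - u) (`|x|^-1 *: y).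
set a := `|_ - _ - _|; move=> ha.
have a_lt : a <= d * (`|y| + 1) by lra.
have y0 := normr_ge0 y.
apply: (@le_lt_trans _ _ (t * (d * (`|y| + 1)))); first by rewrite ler_wpM2l.
rewrite -dE.
have -> : d * ((t + 1) * (`|y| + 2)) =
  t * (d * (`|y| + 1)) + d * (t + `|y| + 2) by ring.
by rewrite ltrDl mulr_gt0 //; lra.
Qed.

Variable L : {vspace 'rV[R]_n}.
Hypothesis LP : forall u, lineality K u <-> u \in L.

(** If u were in L, then v = [coproj L (v - u)] would be small, whereas v has norm one. *)
Lemma limit_coproj_notin u :
  (forall e, 0 < e -> exists v, [/\ coproj L v = v, `|v| = 1 & `|v - u| < e]) ->
  u \notin L.
Proof.
move=> uP; apply/negP => uL; have [C C0 bC] := coproj_bound L.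
have [|v [vE v1 vu]] := uP C^-1; first by rewrite invr_gt0.
have : `|v| < 1; last by rewrite v1 ltxx.
rewrite -vE -[v](subrK u) linearD /= (coproj0 uL) addr0.
by rewrite (le_lt_trans (bC _)) // -ltr_pdivlMl // mulr1.
Qed.

Lemma coproj_mem x : K x -> K (coproj L x).
Proof.
move=> Kx; have /LP/(_ x (-1) Kx) := sub_coproj L x.
by rewrite scaleN1r opprB addrC subrK.
Qed.

(** By [coproj_mem] the projected points lie in K. If they were unbounded, their directions would
    cluster at a recession direction, which is in L, against [limit_coproj_notin]. *)
Lemma maximal_coproj_bounded : exists M, forall x, K x -> `|coproj L x| <= M.
Proof.
apply: contrapT => unb.
have {}unb M : exists2 x, K x & M < `|coproj L x|.
  apply: contrapT => h; apply: unb; exists M => x Kx.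
  by rewrite leNgt; apply/negP => Mx; apply: h; exists x.
pose D (e : R) := [set v | exists x, [/\ K x, coproj L x = x, 0 < `|x|,
  `|x|^-1 < e & v = `|x|^-1 *: x]].
have norm1 (x : 'rV[R]_n) : 0 < `|x| -> `| `|x|^-1 *: x| = 1.
  by move=> x1; rewrite normrZ gtr0_norm ?invr_gt0 // mulVf // gt_eqF.
have [e e0|e v _ [x [_ _ x1 _ ->]]|e e' v _ ee' [x [Kx xE x1 xe vE]]|u uP] :=
    @cluster_point R n 1 D.
- have [x Kx xe] := unb e^-1; exists (`|coproj L x|^-1 *: coproj L x).
  have ei0 : 0 < e^-1 by rewrite invr_gt0.
  exists (coproj L x); split; rewrite ?coproj_id //; first exact: coproj_mem.
    exact: lt_trans xe.
  by rewrite invf_plt ?posrE // (lt_trans ei0).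
- by rewrite norm1.
- by exists x; split=> //; apply: lt_le_trans ee'.
have : u \notin L.
  apply: limit_coproj_notin => e e0.
  have [v [x [Kx xE x1 xe ->]] vu] := uP e e0.
  exists (`|x|^-1 *: x); split=> //; last exact: norm1.
  by rewrite linearZ /= xE.
move=> /negP; apply; apply/LP; apply: recession_limit => e e0.
by have [v [x [Kx xE x1 xe ->]] vu] := uP e e0; exists x.
Qed.

(** Otherwise directions of arbitrarily short vectors p g cluster at some u outside L. Multiples of
    p g approximate any t u, so an interior point z + t u of K would give an interior point z + m p
    g, which is integer up to L. *)
Lemma maximal_coproj_discrete : exists2 d, 0 < d &
  forall z, integer_points z -> `|coproj L z| < d -> coproj L z = 0.
Proof.
apply: contrapT => ndis.
pose p z := coproj L z.
have {}ndis e : 0 < e -> exists z, [/\ integer_points z, `|p z| < e & 0 < `|p z|].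
  move=> e0; apply: contrapT => h; apply: ndis; exists e => // z zZ ze.
  apply: contrapT => z0; apply: h; exists z; split=> //.
  by rewrite normr_gt0; apply/eqP.
pose D (e : R) := [set v | exists z, [/\ integer_points z, `|p z| < e,
  0 < `|p z| & v = `|p z|^-1 *: p z]].
have norm1 (x : 'rV[R]_n) : 0 < `|x| -> `| `|x|^-1 *: x| = 1.
  by move=> x1; rewrite normrZ gtr0_norm ?invr_gt0 // mulVf // gt_eqF.
have [e /ndis[z [zZ ze z0]]|e v _ [z [_ _ z1 ->]]|e e' v _ ee' [z [zZ ze z1 vE]]|u uP] :=
    @cluster_point R n 1 D.
- by exists (`|p z|^-1 *: p z), z.
- by rewrite norm1.
- by exists z; split=> //; apply: lt_le_trans ee'.
have : u \notin L.
  apply: limit_coproj_notin => e e0.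
  have [v [x [Kx xE x1 ->]] vu] := uP e e0.
  exists (`|p x|^-1 *: p x); split=> //; last exact: norm1.
  by rewrite linearZ /= coproj_id.
move=> /negP; apply; apply/LP; apply: lineality_extension => z t zZ.
move=> /interior_normP[e e0 zK].
have t1 : 0 < `|t| + 1 by rewrite ltr_wpDl.
have [|v [g [gZ ge g0 ->]] vu] := uP (e / (`|t| + 1)); first by rewrite divr_gt0.
move: ge vu; set d := e / _ => ge vu.
(* Steps of length |p g| < d approach t up to one step; the direction error adds at most |t| d, in
   total less than e. *)
pose m := Num.floor (t / `|p g|).
have /andP[m1 m2] := floor_itv (t / `|p g|).
have mt : `|m%:~R * `|p g| - t| <= `|p g|.
  move: m1 m2; rewrite -/m ler_pdivlMr // ltr_pdivrMr // intrD mulrDl mul1r.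
  by move=> h1 h2; rewrite ler_norml; apply/andP; split; lra.
have dE : d * (`|t| + 1) = e by rewrite divfK // gt_eqF.
have Km : K° (z + m%:~R *: p g).
  apply: interior_near zK _.
  have -> : z + m%:~R *: p g - (z + t *: u) =
      (m%:~R * `|p g| - t) *: (`|p g|^-1 *: p g) + t *: (`|p g|^-1 *: p g - u).
    apply/rowP => i; rewrite !mxE.
    rewrite mulrBl mulrBr addrA subrK.
    by rewrite -mulrA (mulrA `|p g|) mulfV ?gt_eqF // mul1r; ring.
  rewrite (le_lt_trans (ler_normD _ _)) // !normrZ -normrZ norm1 // mulr1.
  by have := normr_ge0 t; nra.
(* Replacing p g by g is a translation along L, which preserves the interior of K. *)
have := @interior_lineality _ _ _ _ (m%:~R *: (g - p g)) _ Km.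
move=> /(_ (iffRL (LP _) (memvZ _ (sub_coproj L g)))).
rewrite -addrA -scalerDr (addrC (p g)) subrK.
by apply: lattice_freeP => //; apply: integer_pointD => //; apply: integer_pointZ.
Qed.

End Maximal.
(** * Polyhedrality *)

(** A list from S whose span has maximal dimension spans all of S. As 0 is in S, a linear
    combination becomes affine by giving the remaining weight to 0. *)
Lemma span_affine_hull (R : realType) n (S : set 'rV[R]_n) : S 0 ->
  exists b : seq 'rV[R]_n, [/\ forall x, x \in b -> S x,
    forall x, S x -> x \in <<b>>%VS & forall x, x \in <<b>>%VS -> affine_hull S x].
Proof.
move=> S0.
have [|V [b bS VE] Vmax] := @exists_max_dim R n
  (fun V => exists2 b : seq 'rV[R]_n, (forall x, x \in b -> S x) & V = <<b>>%VS) 0%VS.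
  by exists [::] => //; rewrite span_nil.
exists b; split=> // x.
  move=> Sx; rewrite -VE.
  apply: contraT => /dim_addv_line; rewrite ltnNge => /negP[]; apply: Vmax.
  exists (x :: b) => [y|]; first by rewrite inE => /predU1P[->|/bS].
  by rewrite span_cons addvC VE.
move=> /(@coord_span _ _ _ (in_tuple b)) /= xE.
pose c i := coord (in_tuple b) i x.
exists (size b).+1, (fun i => if unlift ord0 i is Some j then b`_j else 0),
  (fun i => if unlift ord0 i is Some j then c j else 1 - \sum_j c j); split=> [i||].
- by case: unliftP => [j _|_] //; apply/bS/mem_nth.
- rewrite big_ord_recl unlift_none.
  by rewrite [X in _ + X](eq_bigr c) ?subrK // => i _; rewrite liftK.
- rewrite big_ord_recl unlift_none scaler0 add0r {1}xE.
  by apply: eq_bigr => i _; rewrite liftK.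
Qed.

(* By Dirichlet a point v of L is close to w / m for some integer w, and w lies
   in L because it is close to L. *)
Lemma lattice_of_discrete (R : realType) n (L : {vspace 'rV[R]_n}) (d : R) :
  0 < d ->
  (forall z, integer_points z -> `|coproj L z| < d -> coproj L z = 0) ->
  lattice_subspace L.
Proof.
move=> d0 dis; pose S := [set` L] `&` @integer_points R n.
have S0 : S 0 by split; [exact: mem0v | exact: integer_point0].
have [b [_ SV VS]] := span_affine_hull S0; set V := <<b>>%VS in SV VS.
have VL v : v \in V -> v \in L.
  rewrite -{2}[v]subr0 => /VS; apply: affine_hull_sub => x [/= xL _].
  by rewrite subr0.
have LV v : v \in L -> v \in V.
  move=> vL; rewrite -coproj_eq0 -normr_eq0 eq_le normr_ge0 andbT.
  have [C C0 bC] := coproj_bound V; have [C' C0' bC'] := coproj_bound L.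
  apply: (le0_mul_eps (ltW C0)) => e e0.
  (* The bound d / C' forces w into L; the bound e makes the projection of m v along V small, and
     dividing by m >= 1 only helps. *)
  have [|m [w [m0 wZ mw]]] := @dirichlet R n v (Num.min e (d / C')).
    by rewrite lt_min e0 divr_gt0.
  move: mw; rewrite lt_min => /andP[mwe mwd].
  have wL : w \in L.
    rewrite -coproj_eq0; apply/eqP/dis => //.
    have -> : coproj L w = coproj L (- (m%:R *: v - w)).
      by rewrite opprB linearB /= [coproj L (_ *: _)]coproj0 ?memvZ // subr0.
    by rewrite (le_lt_trans (bC' _)) // normrN -ltr_pdivlMl // mulrC.
  have wV : w \in V by exact: SV.
  have : `|coproj V (m%:R *: v - w)| <= C * e.
    by rewrite (le_trans (bC _)) // ler_pM2l // ltW.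
  rewrite linearB /= (coproj0 wV) subr0 linearZ /= normrZ normr_nat.
  by apply: le_trans; rewrite ler_peMl // ler1n.
have -> : L = V by apply/vspaceP => v; apply/idP/idP; [exact: LV | exact: VL].
exists 0, V; split=> //; apply/seteqP; split=> x.
  by move=> Sx; apply/minkowski_point; rewrite subr0; apply/LV/VL; move: Sx;
    rewrite -{2}[x]subr0; apply: affine_hull_sub => y [/= yV yZ]; rewrite subr0.
move=> /minkowski_point; rewrite subr0 => /VS.
suff <- : S = [set` V] `&` @integer_points R n by [].
by apply/seteqP; split=> y [/= yL yZ]; split=> //=; [exact: LV | exact: VL].
Qed.

Lemma closed_halfspace (R : realType) n (u : 'rV[R]_n) b :
  closed [set x | dot x u <= b].
Proof.
apply/closed_normP => x xP; have [C C0 bC] := dot_bound u.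
rewrite /= -subr_le0; apply: (le0_mul_eps (ltW C0)) => e e0.
have [y /= yb yx] := xP e e0.
have := bC (y - x); rewrite dotBl => h.
have := ler_norm (- (dot y u - dot x u)); rewrite normrN => h1.
have : C * `|y - x| <= C * e by rewrite ler_pM2l // ltW.
by lra.
Qed.

Lemma nbhs_halfspace (R : realType) n (u : 'rV[R]_n) b x :
  dot x u < b -> nbhs x [set y | dot y u <= b].
Proof.
move=> xb; apply/interior_normP; have [C C0 bC] := dot_bound u.
exists ((b - dot x u) / C) => [|y /= yx]; first by rewrite divr_gt0 // subr_gt0.
have := bC (y - x); rewrite dotBl => h.
have := ler_norm (dot y u - dot x u).
have : C * `|y - x| < b - dot x u by rewrite -ltr_pdivlMl // mulrC.
by lra.
Qed.

(** A small move in the direction u stays in A and strictly raises the value. *)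
Lemma interior_halfspace (R : realType) n (A : set 'rV[R]_n) (u : 'rV[R]_n) b x :
  u != 0 -> (forall y, A y -> dot y u <= b) -> A° x -> dot x u < b.
Proof.
move=> u0 Ab /interior_normP[e e0 xA].
have u1 : 0 < `|u| by rewrite normr_gt0.
pose t := e / (2 * `|u|); have t0 : 0 < t by rewrite divr_gt0 ?mulr_gt0.
have /xA/Ab : `|x + t *: u - x| < e.
  rewrite addrC addKr normrZ gtr0_norm // /t mulrAC ltr_pdivrMr ?mulr_gt0 //.
  by rewrite ltr_pM2l //; lra.
rewrite dotDl dotZl; apply: lt_le_trans; rewrite ltrDl mulr_gt0 //.
exact: dotrr_gt0.
Qed.

(** A functional that is not constant on the line x + R u is unbounded there; the chosen parameter
    yields the value b + 1. *)
Lemma dot_lineality (R : realType) n (K : set 'rV[R]_n) x u c b :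
  K x -> lineality K u -> (forall y, K y -> dot y c <= b) -> dot u c = 0.
Proof.
move=> Kx Ku Kb; apply/eqP; apply: contraT => uc.
have := Kb _ (Ku x ((b - dot x c + 1) / dot u c) Kx).
by rewrite dotDl dotZl divfK //; lra.
Qed.

Lemma polyhedronP (R : realType) n (P : set 'rV[R]_n) :
  polyhedron P <-> exists m (a : 'I_m -> 'rV[R]_n) (b : 'I_m -> R),
    P = [set x | forall i, dot x (a i) <= b i].
Proof.
have E m (A : 'M[R]_(n, m)) x i : (x *m A) 0 i = dot x (\row_j A j i).
  by rewrite dotE mxE; apply: eq_bigr => j _; rewrite mxE.
split=> [[m [A [b ->]]]|[m [a [b ->]]]].
  exists m, (fun i => \row_j A j i), (fun i => b 0 i).
  by apply/seteqP; split=> x xP i; have := xP i; rewrite E.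
exists m, (\matrix_(i, j) a j 0 i), (\row_i b i).
have Ea i : \row_j (\matrix_(i, j) a j 0 i) j i = a i.
  by apply/rowP => j; rewrite !mxE.
by apply/seteqP; split=> x xP i; have := xP i; rewrite mxE E Ea.
Qed.

Lemma polyhedronI (R : realType) n (P Q : set 'rV[R]_n) :
  polyhedron P -> polyhedron Q -> polyhedron (P `&` Q).
Proof.
move=> [m [A [b ->]]] [m' [A' [b' ->]]].
exists (m + m')%N, (row_mx A A'), (row_mx b b'); apply/seteqP; split=> x.
  move=> [xA xA'] i; rewrite mul_mx_row.
  by case: (splitP i) => j ij; rewrite !mxE; case: splitP => k; rewrite ij // => /eqP;
    rewrite ?eqn_add2l => /eqP/val_inj <-.
move=> xP; split=> i /=.
  by have := xP (lshift m' i); rewrite mul_mx_row !row_mxEl.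
by have := xP (rshift m i); rewrite mul_mx_row !row_mxEr.
Qed.

Lemma polyhedron_all (R : realType) n (T : eqType) (s : seq T)
    (u : T -> 'rV[R]_n) (b : T -> R) :
  polyhedron [set x | forall z, z \in s -> dot x (u z) <= b z].
Proof.
apply/polyhedronP; exists (size s), (fun i => u (tnth (in_tuple s) i)),
  (fun i => b (tnth (in_tuple s) i)).
apply/seteqP; split=> x xP; first by move=> i; apply/xP/mem_tnth.
by move=> z /(@tnthP _ _ (in_tuple s))[i ->].
Qed.

(** In the maximum norm a bound amounts to two linear inequalities per coordinate. *)
Lemma polyhedron_norm_le (R : realType) n (f : {linear 'rV[R]_n -> 'rV[R]_n}) M :
  0 <= M -> polyhedron [set x | `|f x| <= M].
Proof.
move=> M0.
have -> : [set x | `|f x| <= M] =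
    [set x | forall i, (x *m lin1_mx f) 0 i <= (const_mx M : 'rV_n) 0 i] `&`
    [set x | forall i, (x *m - lin1_mx f) 0 i <= (const_mx M : 'rV_n) 0 i].
  apply/seteqP; split=> x /=.
    move=> xM; split=> i; rewrite ?mulmxN mul_rV_lin1 !mxE;
      have := le_trans (coord_le_norm (f x) i) xM; rewrite ler_norml; lra.
  move=> [x1 x2]; apply: norm_leP => // i; have := x1 i; have := x2 i.
  rewrite mulmxN mul_rV_lin1 !mxE ler_norml => h1 h2.
  by apply/andP; split; lra.
by apply: polyhedronI; [exists n, (lin1_mx f) | exists n, (- lin1_mx f)];
  exists (const_mx M).
Qed.

Section MaximalPolyhedron.
Variables (R : realType) (n : nat) (K : set 'rV[R]_n) (x0 : 'rV[R]_n).
Variable L : {vspace 'rV[R]_n}.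
Hypotheses (mK : maximal_lattice_free K) (Kx0 : K° x0).
Hypothesis LP : forall u, lineality K u <-> u \in L.

Let lfK : lattice_free K. Proof. by case: mK. Qed.
Let closedK : closed K. Proof. by case: lfK. Qed.
Let convexK : convex_set K. Proof. by case: lfK. Qed.
Let nonemptyK : K x0. Proof. exact: interior_subset Kx0. Qed.

(* The right-hand inequalities define a lattice-free superset of K: they cut off
   an integer point in every class modulo L that meets the strip. *)
Lemma maximal_inequalities (c : 'rV[R]_n -> 'rV[R]_n) (M : R) :
  (forall x, K x -> `|coproj L x| <= M) ->
  (forall z, integer_points z -> c z != 0) ->
  (forall z x, integer_points z -> K x -> dot x (c z) <= dot z (c z)) ->
  exists s : seq 'rV[R]_n, (forall z, z \in s -> integer_points z) /\
    K = [set x | forall z, z \in s -> dot x (c z) <= dot z (c z)] `&`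
        [set x | `|coproj L x| <= M].
Proof.
move=> KM c0 Kc.
have [d d0 dis] := maximal_coproj_discrete mK Kx0 LP.
have [x []//|z z' [zZ _] [z'Z _] zz'|s [sS Ss]] := @finite_representatives R n
  (fun z => integer_points z /\ `|coproj L z| <= M) (coproj L) M d d0.
  apply/eqP; rewrite -subr_eq0 -linearB; apply/eqP/dis; last by rewrite linearB.
  exact: integer_pointB.
exists s; split; first by move=> z /sS[].
apply/seteqP; split=> [x Kx|].
  by split=> [z /sS[zZ _]|] /=; [exact: Kc | exact: KM].
apply: maximal_sub mK _ _; last first.
  by move=> x Kx; split=> [z /sS[zZ _]|] /=; [exact: Kc | exact: KM].
split.
- apply: closedI.
    apply/closed_normP => x xP z zs.
    have /closed_normP := @closed_halfspace R n (c z) (dot z (c z)); apply => e e0.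
    by have [y /(_ z zs) yP yx] := xP e e0; exists y.
  have [C C0 bC] := coproj_bound L.
  apply/closed_normP => x xP /=; rewrite -subr_le0.
  apply: (le0_mul_eps (ltW C0)) => e e0; have [y /= yM yx] := xP e e0.
  rewrite lerBlDr -[x](subKr y) linearB /= (le_trans (ler_normB _ _)) //.
  by rewrite addrC lerD // (le_trans (bC _)) // ler_pM2l // ltW.
- apply/convex_setP => x y t t0 t1 [xs xM] [ys yM].
  have t1' : 0 <= 1 - t by rewrite subr_ge0.
  split=> [z zs|] /=.
    rewrite dotDl !dotZl; have := xs z zs; have := ys z zs.
    move: (dot z (c z)) (dot x _) (dot y _) => a b b'; nra.
  rewrite linearD !linearZ /= (le_trans (ler_normD _ _)) // !normrZ !ger0_norm //.
  move: xM yM => /=; move: `|coproj L x| `|coproj L y| => a b; nra.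
- apply/seteqP; split=> // z [Pz zZ].
  have [zs zM] := interior_subset Pz.
  (* z and z' differ by an element of L, on which c z' vanishes; yet z is strictly inside the
     halfspace whose boundary passes through z'. *)
  have [z' z's zz'] := Ss z (conj zZ zM); have [z'Z _] := sS z' z's.
  have : dot z (c z') < dot z' (c z').
    by apply: (interior_halfspace (c0 z' z'Z) _ Pz) => y [/(_ z' z's)].
  have : dot (z - z') (c z') = 0.
    apply: (dot_lineality nonemptyK); last by move=> y; apply: Kc.
    by apply/LP; rewrite -coproj_eq0 linearB /= zz' subrr.
  by rewrite dotBl; lra.
Qed.

Lemma maximal_polyhedron : polyhedron K.
Proof.
have [M KM] := maximal_coproj_bounded mK Kx0 LP.
have [|c cP] := @choice _ _ (fun z c => integer_points z ->
    c != 0 /\ forall x, K x -> dot x c <= dot z c).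
  move=> z; have [zZ|nzZ] := pselect (integer_points z); last by exists 0.
  have [|u u0 uP] := @supporting_functional R n K z closedK convexK _ (lattice_freeP lfK zZ).
    by exists x0.
  by exists u.
have [|z x /cP[_]|s [_ ->]] := maximal_inequalities KM (c := c); first by move=> z /cP[].
  exact.
apply: polyhedronI; first exact: polyhedron_all.
by apply: polyhedron_norm_le; apply: le_trans (KM x0 _).
Qed.

(** The finite description of K built from these functionals is strict at q, so it holds near q. *)
Lemma maximal_interior q : K q ->
  (forall z, integer_points z -> exists c,
    (forall x, K x -> dot x c <= dot z c) /\ dot q c < dot z c) -> K° q.
Proof.
move=> Kq qc; have [M KM] := maximal_coproj_bounded mK Kx0 LP.
have [|c cP] := @choice _ _ (fun z c => integer_points z ->
    (forall x, K x -> dot x c <= dot z c) /\ dot q c < dot z c).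
  move=> z; have [zZ|nzZ] := pselect (integer_points z); last by exists 0.
  by have [u uP] := qc z zZ; exists u.
(* M + 1 in place of M leaves room around q in the bound on the projection too. *)
have [x Kx|z zZ|z x /cP[zc _]|s [sZ KE]] := @maximal_inequalities c (M + 1).
- by rewrite (le_trans (KM x Kx)) // lerDl.
- by have [_] := cP z zZ; apply: contraTneq => ->; rewrite !dot0r ltxx.
- exact: zc.
rewrite /interior KE; apply: filterI.
  elim: s sZ {KE} => [|z s IHs] sZ; first by apply: filterE => x z.
  have /cP[_ /nbhs_halfspace zq] : integer_points z by apply: sZ; rewrite mem_head.
  have {}IHs := IHs (fun y ys => sZ y (mem_behead (s := z :: s) ys)).
  by apply: filterS (filterI zq IHs) => y [yz ys] z'; rewrite inE => /predU1P[->|/ys].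
have [C C0 bC] := coproj_bound L.
apply/interior_normP; exists C^-1 => [|y yq]; first by rewrite invr_gt0.
rewrite /= -[y](subrK q) linearD /= addrC (le_trans (ler_normD _ _)) // lerD //.
  exact: KM.
by rewrite (le_trans (bC _)) // -ler_pdivlMl // mulr1 ltW.
Qed.

End MaximalPolyhedron.
(** * Facets *)

(** Both q + s v and q - s v lie in S for small s, and neither exceeds the value at q. *)
Lemma ball_in_const (R : realType) n (S : set 'rV[R]_n) q
    (V : {vspace 'rV[R]_n}) (e : R) c :
  0 < e -> ball_in S q V e -> (forall x, S x -> dot x c <= dot q c) ->
  forall v, v \in V -> dot v c = 0.
Proof.
move=> e0 qV Sc v vV.
have v1 : 0 < 2 * (`|v| + 1) by rewrite mulr_gt0 // ltr_wpDl.
pose s := e / (2 * (`|v| + 1)); have s0 : 0 < s by rewrite divr_gt0.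
have sv : `|s *: v| < e.
  rewrite normrZ gtr0_norm // /s mulrAC ltr_pdivrMr // ltr_pM2l //.
  by have := normr_ge0 v; lra.
have /Sc : S (q + s *: v) by apply: qV; rewrite addrC addKr ?memvZ.
have /Sc : S (q - s *: v).
  by apply: qV; rewrite addrC addKr ?normrN // memvN memvZ.
rewrite dotBl dotDl dotZl => h1 h2.
have /eqP : s * dot v c = 0 by lra.
by rewrite mulf_eq0 (gt_eqF s0) => /eqP.
Qed.

Lemma has_dim_nonempty (R : realType) n (S : set 'rV[R]_n) d :
  has_dim S d -> S !=set0.
Proof.
move=> [a [V [E _]]].
have : affine_hull S a by rewrite E; apply/minkowski_point; rewrite subrr mem0v.
move=> [[|k] [p [c [Sp c1 _]]]]; last by exists (p ord0).
by move: c1; rewrite big_ord0 => /esym/eqP; rewrite oner_eq0.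
Qed.

Lemma interior_has_dim (R : realType) n (S : set 'rV[R]_n) x d :
  S° x -> has_dim S d <-> n = d.
Proof.
move=> /interior_normP[e e0 xS].
rewrite (@has_dimP _ _ _ x fullv e) ?dim_rV // => [y _|y _]; first exact: memvf.
exact: xS.
Qed.

Section MaximalForm.
Variables (R : realType) (n : nat) (K : set 'rV[R]_n) (x0 : 'rV[R]_n).
Variable L : {vspace 'rV[R]_n}.
Hypotheses (mK : maximal_lattice_free K) (Kx0 : K° x0).
Hypothesis LP : forall u, lineality K u <-> u \in L.

Let lfK : lattice_free K. Proof. by case: mK. Qed.
Let closedK : closed K. Proof. by case: lfK. Qed.
Let convexK : convex_set K. Proof. by case: lfK. Qed.
Let nonemptyK : K x0. Proof. exact: interior_subset Kx0. Qed.

(* If the relative interior of F misses the integer points, every integer point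
   is weakly separated from K by an inequality that is strict at a relative
   interior point q of F, so that K could be enlarged near q. *)
Lemma maximal_facet F : facet K F ->
  exists2 z, relative_interior F z & integer_points z.
Proof.
move=> [[c [delta [Kc FE]]] [d [dimK dimF]]].
pose u := c^T.
have uE x : (x *m c) 0 0 = dot x u by rewrite /dot trmxK.
have {}FE : F = K `&` [set x | dot x u = delta].
  by rewrite FE; apply/seteqP; split=> x [Kx xd]; split=> //; rewrite /= ?uE // -uE.
have {}Kc x : K x -> dot x u <= delta by rewrite -uE; exact: Kc.
have {}dimK : n = d.+1 by apply/(interior_has_dim _ Kx0).
have [y0 Fy0] := has_dim_nonempty dimF.
(* A zero functional would give F = K, of dimension d + 1 instead of d. *)
have u0 : u != 0.
  apply/eqP => u0; move: dimF Fy0; rewrite FE u0 => dimF [_ /=].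
  rewrite dot0r => d0; move: dimF.
  have -> : K `&` [set x | dot x 0 = delta] = K.
    by apply/seteqP; split=> x; [case|split=> //=; rewrite dot0r].
  by move=> /(interior_has_dim _ Kx0); rewrite dimK => /eqP; rewrite eqn_leq ltnn.
have x0d : dot x0 u < delta by apply: (interior_halfspace u0 Kc).
have convexF : convex_set F.
  rewrite FE; apply/convex_setP => x y t t0 t1 [Kx /= xd] [Ky /= yd]; split.
    by apply: (iffLR (convex_setP K)).
  by rewrite /= dotDl !dotZl xd yd; ring.
have [q [V [e [e0 FV qV]]]] := convex_relint convexF Fy0.
have Fq : F q by apply: qV; rewrite subrr ?mem0v ?normr0.
have [Kq /= qd] : K q /\ dot q u = delta by move: Fq; rewrite FE => -[].
have dimV : \dim V = d by apply/(has_dimP _ e0 FV qV).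
have FK x : F x -> K x by rewrite FE => -[].
have Vc a : (forall x, K x -> dot x a <= dot q a) ->
    forall v, v \in V -> dot v a = 0.
  by move=> Ka; apply: (ball_in_const e0 qV) => x /FK; exact: Ka.
have Vu v : v \in V -> dot v u = 0 by apply: Vc => x /Kc; rewrite qd.
have wu : dot (x0 - q) u < 0 by rewrite dotBl qd subr_lt0.
have wV : x0 - q \notin V by apply: contraTN wu => /Vu ->; rewrite ltxx.
(* Every integer point is therefore q + v + s (x0 - q) with v in V; the sign of s tells its side of
   the facet. *)
have VW : (V + <[x0 - q]>)%VS = fullv.
  apply: dim_rV_full; apply/eqP; rewrite eqn_leq dim_rV_le /=.
  by apply: leq_trans (eq_leq dimK) _; rewrite -dimV; exact: dim_addv_line.
have [m [a [b KE]]] := iffLR (polyhedronP K) (maximal_polyhedron mK Kx0 LP).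
have Kab x i : K x -> dot x (a i) <= b i by rewrite KE; exact.
apply: contrapT => noz.
suff : K° q by move=> /(interior_halfspace u0 Kc); rewrite qd ltxx.
apply: (maximal_interior mK Kx0 LP Kq) => z zZ.
have [[i [zi qi]]|H] := pselect (exists i, b i <= dot z (a i) /\ dot q (a i) < b i).
  by exists (a i); split=> [x /Kab/le_trans|]; [exact | exact: lt_le_trans zi].
(* In the remaining case every inequality of K is tight at q or strict at z. *)
have {}H i : dot q (a i) = b i \/ dot z (a i) < b i.
  have [zi|] := leP (b i) (dot z (a i)); last by right.
  left; apply/eqP; rewrite eq_le Kab //= leNgt; apply/negP => qi.
  by apply: H; exists i.
have tight i : dot q (a i) = b i -> forall v, v \in V -> dot v (a i) = 0.
  by move=> qi; apply: Vc => x /Kab; rewrite qi.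
have : z - q \in (V + <[x0 - q]>)%VS by rewrite VW memvf.
move=> /memv_addP[v vV [_ /vlineP[s ->] zE]].
have zdot y : dot z y = dot q y + (dot v y + s * dot (x0 - q) y).
  by rewrite -dotZl -dotDl -zE -dotDl addrC subrK.
(* For s < 0, z is beyond the facet and u itself separates. For s > 0, the inequalities tight at q
   are strict at z, as at x0, so z would be interior to K. For s = 0, z is in the relative interior
   of F. *)
have [s_lt|s_gt|s0] := ltrgtP s 0.
- exists u; rewrite zdot qd (Vu v vV) add0r.
  have : 0 < s * dot (x0 - q) u by rewrite nmulr_rgt0.
  by move=> su; split=> [x /Kc|]; lra.
- case: (lattice_freeP lfK zZ); rewrite /interior KE.
  apply: (@filter_forall _ _ (fun i x => dot x (a i) <= b i) (nbhs z)) => i.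
  have [ai0|ai0] := eqVneq (a i) 0.
    by apply: filterE => x; have := Kab x0 i nonemptyK; rewrite ai0 !dot0r.
  apply: nbhs_halfspace; have [qi|//] := H i.
  have := @interior_halfspace _ _ _ _ (b i) _ ai0 (fun y => @Kab y i) Kx0.
  rewrite zdot (tight i qi v vV) add0r qi dotBl qi => xi.
  by rewrite gtrDl pmulr_rlt0 // subr_lt0.
- case: noz; exists z => //.
  have zq : z - q = v by rewrite zE s0 scale0r addr0.
  have aux x : x - q \in V ->
      (forall i, dot q (a i) = b i \/ dot x (a i) <= b i) -> F x.
    move=> xV xH; rewrite FE; split.
      rewrite KE => i; have [qi|//] := xH i.
      have := tight i qi _ xV; rewrite dotBl; lra.
    by have := Vu _ xV; rewrite /= dotBl; lra.
  split; first by apply: aux => [|i]; rewrite ?zq //; have [] := H i; [left|right; exact: ltW].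
  exists [set x | forall i, dot q (a i) = b i \/ dot x (a i) <= b i].
    apply: (@filter_forall _ _
      (fun i x => dot q (a i) = b i \/ dot x (a i) <= b i) (nbhs z)) => i.
    have [qi|/nbhs_halfspace] := H i; first by apply: filterE; left.
    by apply: filterS => x xi; right.
  by move=> x [xH /(affine_hull_sub FV) xV]; exact: aux.
Qed.

Lemma maximal_form :
  exists (r : nat) (Q : set 'rV[R]_n) (L : {vspace 'rV[R]_n}),
    [/\ [/\ lattice_subspace L, \dim L = r & (r < n)%N],
        polytope Q /\ has_dim Q (n - r)%N,
        K = minkowski_sum Q [set` L] &
        forall F, facet K F ->
          exists2 z, relative_interior F z & integer_points z].
Proof.
have [d d0 dis] := maximal_coproj_discrete mK Kx0 LP.
have [M KM] := maximal_coproj_bounded mK Kx0 LP.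
have KL x v : v \in L -> K x -> K (x + v).
  by move=> /LP vL Kx; rewrite -[v]scale1r; apply: vL.
(* The section of K by the complement of L. The condition [projv L x] = 0 is written as a norm bound
   so that [polyhedron_norm_le] applies. *)
pose Q := K `&` [set x | `|projv L x| <= 0].
have QE x : Q x <-> K x /\ coproj L x = x.
  rewrite coprojE; split=> -[Kx /= xQ]; split=> //=.
    by move: xQ; rewrite normr_le0 => /eqP ->; rewrite subr0.
  by rewrite normr_le0; apply/eqP/(@addrI _ (x - projv L x)); rewrite subrK addr0.
exists (\dim L), Q, L; split; last exact: maximal_facet.
- split=> //; first exact: lattice_of_discrete dis.
  (* If L were the whole space, 0 = x0 - x0 would be an interior integer point. *)
  rewrite ltn_neqAle dim_rV_le andbT; apply/eqP => /dim_rV_full Lf.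
  apply: (lattice_freeP lfK (@integer_point0 R n)).
  rewrite -(subrr x0); apply: interior_lineality => //.
  by apply/LP; rewrite Lf memvf.
- split; first split.
  + apply: polyhedronI; first exact: maximal_polyhedron mK Kx0 LP.
    exact: polyhedron_norm_le.
  + apply: (@bounded_norm_le _ _ 0 M) => x /QE[Kx xE].
    by rewrite subr0 -xE; exact: KM.
  have /interior_normP[e e0 xK] := Kx0.
  have imE y : y \in limg (coproj L) -> coproj L y = y.
    by move=> /memv_imgP[x _ ->]; rewrite coproj_id.
  apply/(@has_dimP _ _ _ (coproj L x0) (limg (coproj L)) e) => //.
  + by move=> x /QE[_ <-]; rewrite -linearB memv_img ?memvf.
  + move=> y yV ye; apply/QE.
    have yE : coproj L y = y.
      by rewrite -[y](subrK (coproj L x0)) linearD /= coproj_id (imE _ yV).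
    split=> //.
    have : K (y + (x0 - coproj L x0)).
      by apply: xK; rewrite addrA addrAC addrK.
    move=> /(KL _ (- (x0 - coproj L x0))); rewrite addrK; apply.
    by rewrite memvN sub_coproj.
  have kerE : lker (coproj L) = L by apply/vspaceP => v; rewrite memv_ker coproj_eq0.
  have := limg_ker_dim (coproj L) fullv.
  by rewrite capfv kerE => /(canRL (addKn _)); rewrite dim_rV.
- apply/seteqP; split=> x.
    move=> Kx; exists (coproj L x); last first.
      by exists (x - coproj L x); [exact: sub_coproj | rewrite addrC subrK].
    by apply/QE; split; [exact: (coproj_mem LP) | exact: coproj_id].
  by move=> [y [Ky _] [v /= vL <-]]; exact: KL.
Qed.

End MaximalForm.
(** * Hyperplanes *)

(** Some coordinate of the projection along V does not vanish at a point w outside V; this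
    coordinate is the functional. *)
Lemma proper_functional (R : realType) n (V : {vspace 'rV[R]_n}) :
  V <> fullv -> exists2 u, u != 0 & forall v, v \in V -> dot v u = 0.
Proof.
move=> Vf; have [w wV] : exists w, w \notin V.
  apply: contrapT => h; apply: Vf; apply/vspaceP => w; rewrite memvf.
  by apply: contraT => wV; case: h; exists w.
have [k wk] : exists k, coproj V w 0 k != 0.
  apply: contrapT => h; move: wV; rewrite -coproj_eq0 => /eqP; apply.
  apply/rowP => k; rewrite mxE; apply: contrapT => /eqP wk.
  by apply: h; exists k.
pose u := \row_j lin1_mx (coproj V) j k.
have uE x : dot x u = coproj V x 0 k.
  by rewrite -mul_rV_lin1 dotE mxE; apply: eq_bigr => j _; rewrite [in LHS]mxE.
exists u => [|v vV]; last by rewrite uE coproj0 // mxE.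
by apply: contraNneq wk => u0; rewrite -uE u0 dot0r.
Qed.

Lemma hyperplane_vspace (R : realType) n (u : 'rV[R]_n) : u != 0 ->
  exists2 H : {vspace 'rV[R]_n},
    (forall x, x \in H <-> dot x u = 0) & \dim H = n.-1.
Proof.
move=> u0; have [|a x y /= xu yu|H HP] := @subspaceP R n [set x | dot x u = 0].
- by rewrite /= dot0l.
- by rewrite dotDl dotZl xu yu mulr0 addr0.
exists H => [x|]; first exact: (iff_sym (HP x)).
have uu := dotrr_gt0 u0.
have full : (H + <[u]>)%VS = fullv.
  apply/vspaceP => x; rewrite memvf -[x](subrK ((dot x u / dot u u) *: u)).
  apply: memv_add; last by rewrite memvZ // memv_line.
  by apply/HP; rewrite /= dotBl dotZl divfK ?gt_eqF // subrr.
have uH : u \notin H by apply/negP => /HP /= uu0; rewrite uu0 ltxx in uu.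
have h1 : (\dim H < n)%N.
  by have := dim_addv_line uH; rewrite full dim_rV.
have h2 : (n <= (\dim H).+1)%N.
  by have := (dimv_add_leqif H <[u]>).1; rewrite full dim_rV dim_vline u0 addn1.
apply/eqP; rewrite -eqSS prednK ?eqn_leq ?h1 //.
exact: leq_ltn_trans h1.
Qed.

Lemma hyperplane_functional (R : realType) n (L : {vspace 'rV[R]_n}) :
  (0 < n)%N -> \dim L = n.-1 ->
  exists2 u, u != 0 & forall x, x \in L <-> dot x u = 0.
Proof.
move=> n0 dL; have [|u u0 uL] := @proper_functional R n L.
  move=> Lf; have := dim_rV R n; rewrite -Lf dL => E.
  by move: n0; rewrite -ltn_predL E ltnn.
have [H HP dH] := hyperplane_vspace u0.
have LH : L = H.
  by apply/eqP; rewrite eqEdim dL dH leqnn andbT; apply/subvP => v /uL /HP.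
by exists u => // x; rewrite LH.
Qed.

Lemma lattice_free_level (R : realType) n (u : 'rV[R]_n) al : u != 0 ->
  lattice_free [set x | dot x u = al].
Proof.
move=> u0; split.
- rewrite (_ : [set x | _] = [set x | dot x u <= al] `&` [set x | dot x (- u) <= - al]).
    by apply: closedI; exact: closed_halfspace.
  apply/seteqP; split=> x /=; first by move=> xal; rewrite dotNr xal.
  by rewrite dotNr lerN2 => -[h1 h2]; apply/eqP; rewrite eq_le h1.
- apply/convex_setP => x y t _ _ /= xu yu.
  by rewrite dotDl !dotZl xu yu; ring.
- apply/seteqP; split=> // x [xA _].
  have : dot x u < al by apply: (interior_halfspace u0 _ xA) => y /= ->.
  by rewrite (interior_subset xA) ltxx.
Qed.

Lemma lattice_free_slab (R : realType) n (u : 'rV[R]_n) al be : u != 0 ->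
  (forall z, integer_points z -> ~ (al < dot z u < be)) ->
  lattice_free [set x | al <= dot x u <= be].
Proof.
move=> u0 gap; split.
- rewrite (_ : [set x | _] = [set x | dot x u <= be] `&` [set x | dot x (- u) <= - al]).
    by apply: closedI; exact: closed_halfspace.
  by apply/seteqP; split=> x /=; rewrite dotNr lerN2; [case/andP | case=> -> ->].
- apply/convex_setP => x y t t0 t1 /= /andP[x1 x2] /andP[y1 y2].
  rewrite dotDl !dotZl; apply/andP; split; nra.
- apply/seteqP; split=> // z [zA zZ]; apply: (gap z zZ); apply/andP; split.
    rewrite -ltrN2 -dotNr; apply: (interior_halfspace _ _ zA); rewrite ?oppr_eq0 //.
    by move=> y /= /andP[y1 _]; rewrite dotNr lerN2.
  by apply: (interior_halfspace u0 _ zA) => y /= /andP[].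
Qed.

Lemma integer_norm_lt1 (R : realType) n (z : 'rV[R]_n) :
  integer_points z -> `|z| < 1 -> z = 0.
Proof.
move=> /mxOverP zZ z1; apply/rowP => i; rewrite mxE.
have := le_lt_trans (coord_le_norm z i) z1.
have /intrP[m ->] := zZ 0 i.
by rewrite -intr_norm ltrz1 -[1]add0r ltzD1 normr_le0 => /eqP ->.
Qed.

Lemma seq_gap (R : realType) (s : seq R) (al : R) :
  exists2 be, al < be & forall x, x \in s -> al < x -> be <= x.
Proof.
elim: s => [|y s [be albe beP]]; first by exists (al + 1); rewrite ?ltrDl.
exists (if al < y then Num.min be y else be); first by case: ifP; rewrite // lt_min albe.
move=> x; rewrite inE => /predU1P[->|/beP xs] h; first by rewrite h ge_min lexx orbT.
by case: ifP => _; rewrite ?ge_min xs.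
Qed.

(* Modulo the integer points of H, the integer points in a strip parallel to H
   have bounded representatives, so u takes finitely many values on them. *)
Lemma lattice_hyperplane_gap (R : realType) n (u : 'rV[R]_n)
    (H : {vspace 'rV[R]_n}) al :
  u != 0 -> (forall x, x \in H <-> dot x u = 0) -> lattice_subspace H ->
  exists2 be, al < be & forall z, integer_points z -> ~ (al < dot z u < be).
Proof.
move=> u0 HP; rewrite /lattice_subspace; set S := _ `&` _ => dimS.
have S0 : S 0 by split; [exact: mem0v | exact: integer_point0].
have [b [bS Sb spanS]] := span_affine_hull S0.
(* The span of b is contained in H and has the same dimension. *)
have HE : H = <<b>>%VS.
  case: dimS => a [V [E dV]].
  have VE : V = <<b>>%VS.
    apply: (@minkowski_point_inj _ _ a 0); rewrite -E; apply/seteqP; split=> x.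
      move=> Sx; apply/minkowski_point; rewrite subr0; move: Sx; rewrite -{2}[x]subr0.
      by apply: affine_hull_sub => y /Sb; rewrite subr0.
    by move=> /minkowski_point; rewrite subr0 => /spanS.
  apply/eqP; rewrite eq_sym eqEdim -VE dV leqnn andbT VE.
  by apply/span_subvP => x /bS[].
(* Rounding down the coordinates with respect to b moves a point of H by at most M to an integer
   point of H. *)
pose M := \sum_(i < size b) `|b`_i|.
have near h : h \in H -> exists2 s, S s & `|h - s| <= M.
  rewrite HE => /(@coord_span _ _ _ (in_tuple b)) /= hE.
  pose c i := coord (in_tuple b) i h.
  exists (\sum_(i < size b) (Num.floor (c i))%:~R *: b`_i).
    split=> /=.
      by apply: memv_suml => i _; apply: memvZ; have [] := bS _ (mem_nth 0 (ltn_ord i)).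
    elim/big_ind: _ => [||i _]; [exact: integer_point0|exact: integer_pointD|].
    by apply: integer_pointZ; have [] := bS _ (mem_nth 0 (ltn_ord i)).
  rewrite {1}hE -sumrB (le_trans (ler_norm_sum _ _ _)) // ler_sum // => i _.
  rewrite -scalerBl normrZ -[leRHS]mul1r ler_wpM2r //.
  have /andP[] := floor_itv (c i); rewrite intrD => h1 h2.
  by rewrite ger0_norm ?subr_ge0 //; rewrite -/(c i); lra.
have uu := dotrr_gt0 u0.
(* Values of u between al and al + 1 are at most |al| + 1 in absolute value, so the second term
   bounds the component along u. *)
pose M' := M + (`|al| + 1) / dot u u * `|u|.
have [x [_ _ //]|x y [xZ _ _] [yZ _ _] xy|s [sS Ss]] := @finite_representatives R n
  (fun z => [/\ integer_points z, al < dot z u < al + 1 & `|z| <= M']) id M' 1 ltr01.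
  by apply/subr0_eq/integer_norm_lt1 => //; exact: integer_pointB.
have [be albe beP] := seq_gap [seq dot z u | z <- s] al.
exists (Num.min be (al + 1)); first by rewrite lt_min albe ltrDl ltr01.
move=> z zZ; rewrite lt_min => /and3P[zal zbe zal1].
pose r := dot z u / dot u u.
have [s0 [/HP s0H s0Z] s0z] : exists2 s, S s & `|z - r *: u - s| <= M.
  by apply: near; apply/HP; rewrite dotBl dotZl divfK ?gt_eqF // subrr.
have zs0 : dot (z - s0) u = dot z u by rewrite dotBl s0H subr0.
have [|y ys /= zy] := Ss (z - s0).
  split; first exact: integer_pointB.
    by rewrite zs0 zal zal1.
  have -> : z - s0 = (z - r *: u - s0) + r *: u by rewrite addrAC subrK.
  rewrite (le_trans (ler_normD _ _)) // lerD // normrZ ler_wpM2r //.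
  rewrite /r normrM (gtr0_norm (x := _^-1)) ?invr_gt0 // ler_wpM2r ?invr_ge0 ?ltW //.
  by rewrite lter_norml; have := ler_norm al; have := ler_norm (- al); rewrite normrN; lra.
have yz : dot y u = dot z u by rewrite -zs0 zy.
have := beP (dot y u) (map_f (fun x => dot x u) ys).
by rewrite yz zal leNgt zbe => /(_ isT).
Qed.

(** If the interval were missed, an integer point with a nonzero value smaller than be - al in
    absolute value would have a multiple in it. So integer points projecting near 0 lie in L, and
    [lattice_of_discrete] applies. *)
Lemma nonlattice_hyperplane_dense (R : realType) n (u : 'rV[R]_n)
    (L : {vspace 'rV[R]_n}) al be :
  u != 0 -> (forall x, x \in L <-> dot x u = 0) -> ~ lattice_subspace L ->
  al < be -> exists2 z, integer_points z & al < dot z u < be.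
Proof.
move=> u0 LP nL albe; apply: contrapT => gap; apply: nL.
have [C C0 bC] := dot_bound u.
have key z : integer_points z -> 0 < dot z u < be - al -> False.
  move=> zZ /andP[z0 zba]; apply: gap.
  (* The first multiple whose value exceeds al; it overshoots by at most one step. *)
  exists ((Num.floor (al / dot z u) + 1)%:~R *: z); first exact: integer_pointZ.
  have /andP[] := floor_itv (al / dot z u).
  rewrite ler_pdivlMr // ltr_pdivrMr // dotZl => h1 h2.
  by rewrite h2 intrD mulrDl mul1r; lra.
apply: (@lattice_of_discrete _ _ _ ((be - al) / C)).
  by rewrite divr_gt0 // subr_gt0.
move=> z zZ zd; apply/eqP; rewrite coproj_eq0; apply/LP.
have zE : dot z u = dot (coproj L z) u.
  by apply/eqP; rewrite -subr_eq0 -dotBl; apply/eqP/LP; exact: sub_coproj.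
have : `|dot z u| < be - al.
  by rewrite zE (le_lt_trans (bC _)) // -ltr_pdivlMl // mulrC.
rewrite ltr_norml => /andP[h1 h2].
have [z_lt|z_gt|//] := ltrgtP (dot z u) 0.
  by case: (key (- z)); [exact: integer_pointN | rewrite dotNl; lra].
by case: (key z zZ); rewrite z_gt.
Qed.

Lemma slab_interior (R : realType) n (K : set 'rV[R]_n) (u y z : 'rV[R]_n) al :
  convex_set K -> (forall x, dot x u = al -> K x) -> K y ->
  al < dot z u < dot y u -> K° z.
Proof.
move=> /convex_setP cK aK Ky /andP[z1 z2].
have : nbhs z ([set x | dot x u <= (dot z u + dot y u) / 2] `&`
               [set x | dot x (- u) <= - ((al + dot z u) / 2)]).
  by apply: filterI; apply: nbhs_halfspace; rewrite ?dotNr; lra.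
apply: filterS => x [/= x2]; rewrite dotNr lerN2 => x1.
have yal : 0 < dot y u - al by lra.
(* Chosen so that the line from y through x meets the hyperplane of level al at (x - t y) / (1 -
   t). *)
pose t := (dot x u - al) / (dot y u - al).
have t0 : 0 <= t by rewrite divr_ge0 // ?ltW //; lra.
have t1 : t < 1 by rewrite ltr_pdivrMr // mul1r; lra.
have tE : t * (dot y u - al) = dot x u - al by rewrite divfK // gt_eqF.
have t1' : 1 - t != 0 by rewrite subr_eq0 gt_eqF.
have -> : x = (1 - t) *: ((1 - t)^-1 *: (x - t *: y)) + t *: y.
  by rewrite scalerA mulfV // scale1r subrK.
apply: cK => //; first exact: ltW.
apply: aK; rewrite dotZl dotBl dotZl; apply: (mulfI t1'); rewrite mulrA mulfV // mul1r.
by lra.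
Qed.

(** A point y outside the hyperplane adds a whole slab to any convex superset, and density puts an
    integer point in its interior; u and -u serve the two sides. *)
Lemma nonlattice_hyperplane_maximal (R : realType) n (a : 'rV[R]_n)
    (L : {vspace 'rV[R]_n}) :
  (0 < n)%N -> \dim L = n.-1 -> ~ lattice_subspace L ->
  maximal_lattice_free (minkowski_sum [set a] [set` L]).
Proof.
move=> n0 dL nL; have [u u0 LP] := hyperplane_functional n0 dL.
have -> : minkowski_sum [set a] [set` L] = [set x | dot x u = dot a u].
  apply/seteqP; split=> x; first by move=> /minkowski_point/LP; rewrite dotBl /=; lra.
  by move=> /= xa; apply/minkowski_point/LP; rewrite dotBl xa subrr.
split; first exact: lattice_free_level.
move=> K' lfK' [sK nsK]; apply: nsK => y K'y; apply: contrapT => /eqP /= ya.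
have [_ cK' _] := lfK'.
have key v : v != 0 -> (forall x, x \in L <-> dot x v = 0) ->
    (forall x, dot x v = dot a v -> K' x) -> dot a v < dot y v -> False.
  move=> v0 LPv aK' ay.
  have [z zZ zy] := nonlattice_hyperplane_dense v0 LPv nL ay.
  exact: lattice_freeP lfK' zZ (slab_interior cK' aK' K'y zy).
move: ya; rewrite neq_lt => /orP[ya|ya]; last by apply: (key u) => // x /sK.
apply: (key (- u)); rewrite ?oppr_eq0 ?dotNr ?ltrN2 // => x.
  by rewrite LP dotNr; split=> [->|/eqP]; rewrite ?oppr0 // oppr_eq0 => /eqP.
by rewrite !dotNr => /oppr_inj /sK.
Qed.

Lemma maximal_empty_interior (R : realType) n (K : set 'rV[R]_n) :
  (0 < n)%N -> maximal_lattice_free K -> (forall x, ~ K° x) ->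
  exists (a : 'rV[R]_n) (L : {vspace 'rV[R]_n}),
    [/\ K = minkowski_sum [set a] [set` L], \dim L = n.-1 & ~ lattice_subspace L].
Proof.
move=> n0 mK K0; have [[_ cK _] _] := mK.
have [a [V Vf KV]] : exists a, exists2 V : {vspace 'rV[R]_n}, V <> fullv &
    forall x, K x -> x - a \in V.
  (* An empty K fits into any flat, and n > 0 makes the zero subspace proper. *)
  have [[x Kx]|Ke] := pselect (K !=set0); last first.
    exists 0, 0%VS => [E|x Kx]; last by case: Ke; exists x.
    by have := dim_rV R n; rewrite -E dimv0 => n0'; rewrite -n0' in n0.
  have [a [V [e [e0 KV aV]]]] := convex_relint cK Kx; exists a, V => // Vf.
  apply: (K0 a); apply/interior_normP; exists e => // y; apply: aV.
  by rewrite Vf memvf.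
have [u u0 uV] := proper_functional Vf.
have [H HP dH] := hyperplane_vspace u0.
have KE : K = [set x | dot x u = dot a u].
  have KsubK' : K `<=` [set x | dot x u = dot a u].
    by move=> x /KV /uV; rewrite dotBl /=; lra.
  apply/seteqP; split=> //.
  exact: (maximal_sub mK (lattice_free_level _ u0) KsubK').
exists a, H; split=> //.
  rewrite KE; apply/seteqP; split=> x /=.
    by move=> xa; apply/minkowski_point/HP; rewrite dotBl xa subrr.
  by move=> /minkowski_point/HP; rewrite dotBl; lra.
move=> /(lattice_hyperplane_gap (dot a u) u0 HP)[be albe gap].
have uu := dotrr_gt0 u0.
(* This point lies on the far side of the lattice-free slab, at level be, while K is confined to the
   level of a. *)
have : K (a + ((be - dot a u) / dot u u) *: u).
  apply: (maximal_sub mK (lattice_free_slab u0 gap)).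
    by move=> x; rewrite KE /= => ->; rewrite lexx ltW.
  by rewrite /= dotDl dotZl divfK ?gt_eqF //; lra.
rewrite KE /= dotDl dotZl divfK ?gt_eqF //; lra.
Qed.
(* A point y outside K violates some inequality of an irredundant description of
   K.  The integer point in the relative interior of the corresponding facet is
   then interior to any convex set containing K and y. *)
Lemma polyhedral_maximal (R : realType) n (K : set 'rV[R]_n) :
  (0 < n)%N -> polyhedron K -> has_dim K n -> lattice_free K ->
  (forall F, facet K F -> exists2 z, relative_interior F z & integer_points z) ->
  maximal_lattice_free K.
Proof.
move=> n0 /polyhedronP[m [a [b KE0]]] dimK lfK facetK.
have [_ cK _] := lfK.
have [x0 Kx0] : exists x0, K° x0.
  have [x Kx] := has_dim_nonempty dimK.
  have [x0 [V [e [e0 KV x0V]]]] := convex_relint cK Kx.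
  have /(has_dimP _ e0 KV x0V)/dim_rV_full Vf := dimK.
  exists x0; apply/interior_normP; exists e => // y; apply: x0V.
  by rewrite Vf memvf.
pose sol (I : {set 'I_m}) := [set x | forall i, i \in I -> dot x (a i) <= b i].
(* A minimal set of inequalities describing K: dropping any one of them enlarges the set. *)
have [|I /minsetP[/asboolP KE Imin] _] :=
  @minset_exists _ (fun I => `[< K = sol I >]) [set: 'I_m].
  by apply/asboolP; rewrite KE0; apply/seteqP; split=> x xP i; [move=> _|]; apply: xP.
have redundant i : i \in I -> K <> sol (I :\ i).
  move=> iI E; have /setP/(_ i) := Imin _ (asboolT E) (subD1set _ _).
  by rewrite !inE eqxx iI.
have Kab x i : K x -> i \in I -> dot x (a i) <= b i by rewrite KE; exact.
have solD1 i x : i \in I -> sol (I :\ i) x -> dot x (a i) <= b i -> K x.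
  move=> iI xI xi; rewrite KE => j jI; have [->//|ji] := eqVneq j i.
  by apply: xI; rewrite !inE ji.
have Ksol i : K `<=` sol (I :\ i).
  by move=> x; rewrite KE => xI j; rewrite inE => /andP[_ /xI].
have Kx0' : K x0 := interior_subset Kx0.
have a0 i : i \in I -> a i != 0.
  move=> iI; apply/eqP => ai0; apply: (redundant i iI); apply/seteqP; split=> // x xI.
  by apply: (solD1 i) => //; have := Kab _ _ Kx0' iI; rewrite ai0 !dot0r.
have x0ab i : i \in I -> dot x0 (a i) < b i.
  by move=> iI; apply: (interior_halfspace (a0 i iI) _ Kx0) => y Ky; apply: Kab.
split=> // K' lfK' [sK nsK]; apply: nsK => y K'y; apply: contrapT => nKy.
have [i iI yi] : exists2 i, i \in I & b i < dot y (a i).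
  apply: contrapT => h; apply: nKy; rewrite KE => i iI.
  by rewrite leNgt; apply/negP => yi; apply: h; exists i.
(* By irredundancy some w violates inequality i only. *)
have [w wI wi] : exists2 w, sol (I :\ i) w & b i < dot w (a i).
  apply: contrapT => h; apply: (redundant i iI); apply/seteqP; split=> // x xI.
  apply: (solD1 i) => //; rewrite leNgt; apply/negP => xi.
  by apply: h; exists x.
have crossing x : b i < dot x (a i) -> exists t, [/\ 0 <= t, t < 1 &
    dot ((1 - t) *: x0 + t *: x) (a i) = b i].
  move=> xi; have x0i := x0ab i iI.
  have D0 : 0 < dot x (a i) - dot x0 (a i) by lra.
  exists ((b i - dot x0 (a i)) / (dot x (a i) - dot x0 (a i))); split.
  - by rewrite divr_ge0 // ltW // subr_gt0.
  - by rewrite ltr_pdivrMr // mul1r ltrD2r.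
  - have := divfK (lt0r_neq0 D0) (b i - dot x0 (a i)).
    by rewrite dotDl !dotZl; set t := _ / _; nra.
have [H HP dH] := hyperplane_vspace (a0 i iI).
(* Between x0 and w, at p, inequality i is tight and all others are strict; near p the face F thus
   fills its hyperplane, hence is a facet. *)
have [t [t0 t1]] := crossing w wi; set p := _ + _ => pi.
have pab j : j \in I :\ i -> dot p (a j) < b j.
  move=> jI; have wj := wI j jI; move: jI; rewrite !inE => /andP[_ jI].
  have := x0ab j jI; rewrite /p dotDl !dotZl; nra.
pose F := K `&` [set x | dot x (a i) = b i].
have FH x : F x -> x - p \in H by move=> [_ /= xi]; apply/HP; rewrite dotBl xi pi subrr.
have [e e0 pF] : exists2 e, 0 < e & ball_in F p H e.
  have : nbhs p [set x | forall j, j \in I :\ i -> dot x (a j) <= b j].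
    apply: (@filter_forall _ _ (fun j x => j \in I :\ i -> dot x (a j) <= b j) (nbhs p)) => j.
    have [jI|_] := boolP (j \in I :\ i); last by apply: filterE.
    by apply: filterS (nbhs_halfspace (pab j jI)) => x xj _.
  move=> /interior_normP[e e0 pe]; exists e => // x /HP; rewrite dotBl pi => xi xp.
  by have {}xi : dot x (a i) = b i; [lra | split=> //; apply: (solD1 i); rewrite ?xi //; exact: pe].
have facetF : facet K F.
  split; first exists (a i)^T, (b i).
    split=> [x Kx|]; first exact: Kab.
    by [].
  exists n.-1; rewrite prednK //; split=> //.
  by apply/(has_dimP _ e0 FH pF).
have [z [[Kz /= zi] [U Uz UF]] zZ] := facetK F facetF.
apply: (lattice_freeP lfK' zZ); have [clK' cK' _] := lfK'.
apply: contrapT => nz.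
have [|c c0 cz] := supporting_functional clK' cK' _ nz; first by exists y.
have [e' e'0 zF] : exists2 e', 0 < e' & ball_in F z H e'.
  have /interior_normP[e' e'0 zU] := Uz; exists e' => // x xH xz.
  apply: UF; split; first exact: zU.
  rewrite (affine_hullE e0 FH pF); apply/minkowski_point.
  by rewrite -(subrK z x) -addrA rpredD // FH.
have Hc v : v \in H -> dot v c = 0.
  by apply: (ball_in_const e'0 zF) => x [/sK/cz].
have x0c : dot x0 c < dot z c.
  by apply: (interior_halfspace c0 _ Kx0) => x /sK/cz.
(* c is constant on the facet hyperplane, so its value at q is that at z. But q is a combination of
   y, where c is at most that value, and x0, where c is smaller, with positive weight on x0. *)
have [s [s0 s1]] := crossing y yi; set q := _ + _ => qi.
have : dot (q - z) c = 0 by apply: Hc; apply/HP; rewrite dotBl qi zi subrr.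
have := cz y K'y; rewrite dotBl /q dotDl !dotZl; nra.
Qed.

(** * The characterization *)

Theorem theorem4p9 (R : realType) (n : nat) (n_gt0 : (0 < n)%N)
    (K : set 'rV[R]_n) :
  maximal_lattice_free K <->
  (exists (a : 'rV[R]_n) (L : {vspace 'rV[R]_n}),
     [/\ K = minkowski_sum [set a] [set` L],
         \dim L = n.-1 &
         ~ lattice_subspace L])
  \/
  ([/\ polyhedron K, has_dim K n & lattice_free K] /\
   exists (r : nat) (Q : set 'rV[R]_n) (L : {vspace 'rV[R]_n}),
     [/\ [/\ lattice_subspace L, \dim L = r & (r < n)%N],
         polytope Q /\ has_dim Q (n - r)%N,
         K = minkowski_sum Q [set` L] &
         forall F : set 'rV[R]_n, facet K F ->
           exists2 z : 'rV[R]_n,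
             relative_interior F z & integer_points z]).
Proof.
split=> [mK|[[a [L [-> dL nL]]]|[[pK dK lfK] [r [Q [L [_ _ _ facetK]]]]]]].
- have [[x0 Kx0]|K0] := pselect (exists x, K° x); last first.
    left; apply: maximal_empty_interior => // x Kx; apply: K0; by exists x.
  have [L LP] := lineality_subspace K.
  right; split; last exact: maximal_form mK Kx0 LP.
  split; [exact: maximal_polyhedron mK Kx0 LP | by apply/(interior_has_dim _ Kx0)|].
  by case: mK.
- exact: nonlattice_hyperplane_maximal.
- exact: polyhedral_maximal.
Qed.
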